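(* Let $\Bbbk$ be a field of characteristic $0$. For each $n\geq 4$, the graded Lie algebras $\mathrm{gr}(P_n,\Bbbk)$, $\mathrm{gr}(\Pi_n,\Bbbk)$, and $\mathrm{gr}(wP^+_n,\Bbbk)$ are pairwise non-isomorphic (as graded Lie algebras).
   Context: For a group $G$ with lower central series $\Gamma_1G=G$, $\Gamma_{k+1}G=[\Gamma_kG,G]$, the associated graded Lie algebra is $\mathrm{gr}(G,\Bbbk)=\bigoplus_{k\ge 1}(\Gamma_kG/\Gamma_{k+1}G)\otimes\Bbbk$, with Lie bracket induced by the group commutator. $F_m$ denotes the free group of rank $m$; $F_n=\langle x_1,\dots,x_n\rangle$. $P_n$ is the pure braid group on $n$ strands: the kernel of the homomorphism $B_n\to S_n$, $\sigma_i\mapsto (i,i+1)$, where $B_n$ is the Artin braid group, generated by $\sigma_1,\dots,\sigma_{n-1}$ with relations $\sigma_i\sigma_j=\sigma_j\sigma_i$ for $|i-j|\ge 2$ and $\sigma_i\sigma_{i+1}\sigma_i=\sigma_{i+1}\sigma_i\sigma_{i+1}$ for $1\le i\le n-2$. $\Pi_n=F_1\times F_2\times\cdots\times F_{n-1}$ (direct product). $wP_n^+$ is the upper welded pure braid group (upper McCool group): the subgroup of $\mathrm{Aut}(F_n)$ generated by the automorphisms $\alpha_{ij}$ with $1\le j<i\le n$, where $\alpha_{ij}$ sends $x_i$ to $x_jx_ix_j^{-1}$ and fixes all other generators $x_k$. *)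

(* Defs.v *)
From HB Require Import structures.
From mathcomp Require Import all_boot all_order all_algebra all_fingroup.
From mathcomp Require Import zify.
From mathcomp Require Import generic_quotient boolp.

Set Implicit Arguments.
Unset Strict Implicit.
Unset Printing Implicit Defensive.

Import GRing.Theory.

Section MorphLemmas.
Local Open Scope group_scope.
Variables (G H : groupType) (f : G -> H).
Hypothesis fM : {morph f : x y / x * y}.

Lemma morphg1 : f 1 = 1.
Proof. by apply: (mulgI (f 1)); rewrite -fM !mulg1. Qed.

Lemma morphgV x : f x^-1 = (f x)^-1.
Proof. by apply: (mulgI (f x)); rewrite -fM !mulgV morphg1. Qed.

End MorphLemmas.

Section SubgroupType.
Local Open Scope group_scope.
Variables (G : groupType) (S : groupClosed G).

Record subgroup_type := Subg { subg_val : G; _ : subg_val \in S }.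

HB.instance Definition _ := [isSub for subg_val].
HB.instance Definition _ := [Choice of subgroup_type by <:].

Fact subgroup_type_closed : group_closed S.
Proof. by split; [exact: gpred1 | move=> x y; exact: gpredF]. Qed.

HB.instance Definition _ :=
  SubChoice_isSubGroup.Build G _ subgroup_type subgroup_type_closed.

End SubgroupType.

Section Kernel.
Local Open Scope group_scope.
Variables (G H : groupType) (f : UMagmaMorphism.type G H).

Definition gker : {pred G} := fun x => f x == 1.

Fact gker_mul1 : 1 \in gker. Proof. by rewrite unfold_in gmulf1. Qed.
Fact gker_mulM : mulg_closed gker.
Proof.
by move=> x y; rewrite !unfold_in gmulfM => /eqP-> /eqP->; rewrite mulg1.
Qed.
Fact gker_mulV : invg_closed gker.
Proof.
move=> x; rewrite !unfold_in => /eqP fx1.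
by rewrite -[f _]mul1g -{1}fx1 -gmulfM mulgV gmulf1.
Qed.

HB.instance Definition _ := isMulClosed.Build G gker gker_mulM.
HB.instance Definition _ := isMul1Closed.Build G gker gker_mul1.
HB.instance Definition _ := isInvClosed.Build G gker gker_mulV.

End Kernel.

Section Generated.
Local Open Scope group_scope.
Variables (G : groupType) (A : G -> Prop).

Inductive generated : G -> Prop :=
| gen_in x of A x : generated x
| gen_one : generated 1
| gen_mul x y of generated x & generated y : generated (x * y)
| gen_inv x of generated x : generated x^-1.

Definition gen : {pred G} := fun x => `[< generated x >].

Lemma genP x : reflect (generated x) (x \in gen). Proof. exact: asboolP. Qed.

Fact gen_mul1 : 1 \in gen. Proof. by apply/genP; exact: gen_one. Qed.
Fact gen_mulM : mulg_closed gen.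
Proof. by move=> x y /genP gx /genP gy; apply/genP; exact: gen_mul. Qed.
Fact gen_mulV : invg_closed gen.
Proof. by move=> x /genP gx; apply/genP; exact: gen_inv. Qed.

HB.instance Definition _ := isMulClosed.Build G gen gen_mulM.
HB.instance Definition _ := isMul1Closed.Build G gen gen_mul1.
HB.instance Definition _ := isInvClosed.Build G gen gen_mulV.

End Generated.

Section DirectProduct.
Local Open Scope group_scope.
Variables (I : Type) (G : I -> groupType).

Definition dprodg : Type := forall i, G i.

HB.instance Definition _ := gen_eqMixin dprodg.
HB.instance Definition _ := gen_choiceMixin dprodg.

Definition dprodg_one : dprodg := fun=> 1.
Definition dprodg_inv (f : dprodg) : dprodg := fun i => (f i)^-1.
Definition dprodg_mul (f g : dprodg) : dprodg := fun i => f i * g i.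

Fact dprodg_mulA : associative dprodg_mul.
Proof.
by move=> f g h; apply: functional_extensionality_dep => i; exact: mulgA.
Qed.
Fact dprodg_mul1g : left_id dprodg_one dprodg_mul.
Proof.
by move=> f; apply: functional_extensionality_dep => i; exact: mul1g.
Qed.
Fact dprodg_mulg1 : right_id dprodg_one dprodg_mul.
Proof.
by move=> f; apply: functional_extensionality_dep => i; exact: mulg1.
Qed.
Fact dprodg_mulVg : left_inverse dprodg_one dprodg_inv dprodg_mul.
Proof.
by move=> f; apply: functional_extensionality_dep => i; exact: mulVg.
Qed.
Fact dprodg_mulgV : right_inverse dprodg_one dprodg_inv dprodg_mul.
Proof.
by move=> f; apply: functional_extensionality_dep => i; exact: mulgV.
Qed.

HB.instance Definition _ := isGroup.Build dprodg
  dprodg_mulA dprodg_mul1g dprodg_mulg1 dprodg_mulVg dprodg_mulgV.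

End DirectProduct.

Section Automorphisms.
Local Open Scope group_scope.
Variable G : groupType.

Record autg := Autg {
  autg_fun :> G -> G;
  autg_funV : G -> G;
  autgM : {morph autg_fun : x y / x * y};
  autgK : cancel autg_fun autg_funV;
  autgVK : cancel autg_funV autg_fun }.

HB.instance Definition _ := gen_eqMixin autg.
HB.instance Definition _ := gen_choiceMixin autg.

Lemma autgP (f g : autg) : f =1 g -> f = g.
Proof.
case: f g => [f f' fM fK f'K] [g g' gM gK g'K] /= /funext fg.
case: g / fg in gM gK g'K *.
have f'g' : f' = g' by apply/funext => x; rewrite -{1}(g'K x) fK.
case: g' / f'g' in gK g'K *.
by congr Autg; apply: Prop_irrelevance.
Qed.

Definition autg_one : autg :=
  @Autg id id (fun _ _ => erefl) (fun=> erefl) (fun=> erefl).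

Fact autg_invM (f : autg) : {morph autg_funV f : x y / x * y}.
Proof.
by move=> x y; apply: (can_inj (autgK f)); rewrite autgM !autgVK.
Qed.
Definition autg_inv (f : autg) : autg :=
  Autg (autg_invM f) (autgVK f) (autgK f).

Fact autg_mulM (f g : autg) : {morph f \o g : x y / x * y}.
Proof. by move=> x y; rewrite /= !autgM. Qed.
Definition autg_mul (f g : autg) : autg :=
  Autg (autg_mulM f g) (can_comp (autgK f) (autgK g))
       (can_comp (autgVK g) (autgVK f)).

Fact autg_mulA : associative autg_mul.
Proof. by move=> f g h; apply: autgP. Qed.
Fact autg_mul1g : left_id autg_one autg_mul.
Proof. by move=> f; apply: autgP. Qed.
Fact autg_mulg1 : right_id autg_one autg_mul.
Proof. by move=> f; apply: autgP. Qed.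
Fact autg_mulVg : left_inverse autg_one autg_inv autg_mul.
Proof. by move=> f; apply: autgP => x; exact: autgK. Qed.
Fact autg_mulgV : right_inverse autg_one autg_inv autg_mul.
Proof. by move=> f; apply: autgP => x; exact: autgVK. Qed.

HB.instance Definition _ := isGroup.Build autg
  autg_mulA autg_mul1g autg_mulg1 autg_mulVg autg_mulgV.

End Automorphisms.

Section Presentation.
Local Open Scope group_scope.
Local Open Scope quotient_scope.
Variable I : choiceType.

(* the letter (i, false) is the generator i and (i, true) its inverse *)
Definition word := seq (I * bool).
Implicit Types u v w : word.

Definition letterV (l : I * bool) := (l.1, ~~ l.2).
Definition wordV w : word := rev (map letterV w).

Variable R : word -> word -> Prop.

Inductive word_eq : word -> word -> Prop :=
| word_refl w : word_eq w w
| word_sym u v of word_eq u v : word_eq v u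
| word_trans u v w of word_eq u v & word_eq v w : word_eq u w
| word_cat u u' v v' of word_eq u u' & word_eq v v' :
    word_eq (u ++ v) (u' ++ v')
| word_cancel l : word_eq [:: l; letterV l] [::]
| word_rel u v of R u v : word_eq u v.

Definition word_eqb u v := `[< word_eq u v >].

Fact word_eqb_refl : reflexive word_eqb.
Proof. by move=> w; apply/asboolP; exact: word_refl. Qed.
Fact word_eqb_sym : symmetric word_eqb.
Proof.
by move=> u v; apply/asboolP/asboolP => ?; exact: word_sym.
Qed.
Fact word_eqb_trans : transitive word_eqb.
Proof.
by move=> v u w /asboolP uv /asboolP vw; apply/asboolP; exact: word_trans vw.
Qed.

Canonical word_equiv := EquivRel word_eqb word_eqb_refl word_eqb_sym
  word_eqb_trans.

Definition presg := {eq_quot word_equiv}.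

HB.instance Definition _ := Choice.on presg.
HB.instance Definition _ := Quotient.on presg.
HB.instance Definition _ := EqQuotient.on presg.

Lemma presP u v : \pi_presg u = \pi_presg v <-> word_eq u v.
Proof.
by split=> [/(eqquotP presg)/asboolP//|uv]; apply/(eqquotP presg)/asboolP.
Qed.

Lemma letterVK : involutive letterV.
Proof. by case=> i b; rewrite /letterV /= negbK. Qed.

Lemma word_catV w : word_eq (wordV w ++ w) [::].
Proof.
rewrite /wordV; elim: w => [|l w IHw]; first exact: word_refl.
rewrite map_cons rev_cons -cats1 -catA /=.
apply: word_trans IHw; apply: word_cat; first exact: word_refl.
rewrite -[l :: w]cat1s -cat1s catA -[X in word_eq _ X]cat0s.
apply: word_cat; last exact: word_refl.
by have := word_cancel (letterV l); rewrite letterVK.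
Qed.

Lemma wordVK : involutive wordV.
Proof.
by move=> w; rewrite /wordV map_rev revK -map_comp map_id_in// => l _ /=;
   rewrite letterVK.
Qed.

Lemma word_Vcat w : word_eq (w ++ wordV w) [::].
Proof. by have := word_catV (wordV w); rewrite wordVK. Qed.

Lemma word_eqV u v : word_eq u v -> word_eq (wordV u) (wordV v).
Proof.
move=> uv; apply: (@word_trans _ (wordV u ++ (v ++ wordV v))).
  rewrite -[X in word_eq X _]cats0; apply: word_cat; first exact: word_refl.
  exact/word_sym/word_Vcat.
apply: (@word_trans _ (wordV u ++ (u ++ wordV v))).
  apply: word_cat; first exact: word_refl.
  by apply: word_cat; [exact: word_sym | exact: word_refl].
rewrite catA -[X in word_eq _ X]cat0s.
by apply: word_cat; [exact: word_catV | exact: word_refl].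
Qed.

Definition pres_one : presg := \pi_presg [::].
Definition pres_inv (x : presg) : presg := \pi_presg (wordV (repr x)).
Definition pres_mul (x y : presg) : presg := \pi_presg (repr x ++ repr y).

Lemma word_repr w : word_eq (repr (\pi_presg w)) w.
Proof. by apply/presP; rewrite reprK. Qed.

Lemma pres_mulE u v : pres_mul (\pi_presg u) (\pi_presg v) = \pi_presg (u ++ v).
Proof. by apply/presP; apply: word_cat; exact: word_repr. Qed.

Lemma pres_invE u : pres_inv (\pi_presg u) = \pi_presg (wordV u).
Proof. by apply/presP; apply: word_eqV; exact: word_repr. Qed.

Fact pres_mulA : associative pres_mul.
Proof.
elim/quotW=> u; elim/quotW=> v; elim/quotW=> w.
by rewrite (pres_mulE v w) (pres_mulE u v) !pres_mulE catA.
Qed.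
Fact pres_mul1g : left_id pres_one pres_mul.
Proof. by elim/quotW=> u; rewrite pres_mulE. Qed.
Fact pres_mulg1 : right_id pres_one pres_mul.
Proof. by elim/quotW=> u; rewrite pres_mulE cats0. Qed.
Fact pres_mulVg : left_inverse pres_one pres_inv pres_mul.
Proof.
by elim/quotW=> u; rewrite pres_invE pres_mulE; apply/presP; exact: word_catV.
Qed.
Fact pres_mulgV : right_inverse pres_one pres_inv pres_mul.
Proof.
by elim/quotW=> u; rewrite pres_invE pres_mulE; apply/presP; exact: word_Vcat.
Qed.

HB.instance Definition _ := isGroup.Build presg
  pres_mulA pres_mul1g pres_mulg1 pres_mulVg pres_mulgV.

Definition pgen (i : I) : presg := \pi_presg [:: (i, false)].

Lemma pgenV i : (pgen i)^-1 = \pi_presg [:: (i, true)].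
Proof. exact: pres_invE. Qed.

Section Lift.
Variables (H : groupType) (f : I -> H).

Definition letter_val (l : I * bool) : H := if l.2 then (f l.1)^-1 else f l.1.
Definition word_val w : H := \prod_(l <- w) letter_val l.

(* the homomorphism extending f, when f is compatible with R *)
Definition pres_lift (x : presg) : H := word_val (repr x).

Hypothesis fR : forall u v, R u v -> word_val u = word_val v.

Lemma word_val_eq u v : word_eq u v -> word_val u = word_val v.
Proof.
elim=> {u v} [//|//|u v w _ -> //|u u' v v' _ uu' _ vv'|[i b]|]; last exact: fR.
  by rewrite /word_val !big_cat; congr mul.
rewrite /word_val !big_cons !big_nil mulg1 /letter_val/=.
by case: b; rewrite /= (mulVg, mulgV).
Qed.

Lemma pres_liftE w : pres_lift (\pi_presg w) = word_val w.
Proof. exact/word_val_eq/word_repr. Qed.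

Lemma pres_lift_gen i : pres_lift (pgen i) = f i.
Proof. by rewrite pres_liftE /word_val big_seq1. Qed.

Lemma pres_liftM : {morph pres_lift : x y / x * y}.
Proof.
elim/quotW=> u; elim/quotW=> v; rewrite [_ * _]pres_mulE !pres_liftE.
by rewrite /word_val big_cat.
Qed.

Lemma pres_lift1 : pres_lift 1 = 1.
Proof. by rewrite pres_liftE /word_val big_nil. Qed.

End Lift.

Lemma pres_ext (H : groupType) (g h : presg -> H) :
    {morph g : x y / x * y} -> {morph h : x y / x * y} ->
  (forall i, g (pgen i) = h (pgen i)) -> g =1 h.
Proof.
move=> gM hM gh; elim/quotW; elim=> [|[i b] w IHw].
  by rewrite -/pres_one -[pres_one]/(1 : presg) !morphg1.
have -> : \pi_presg ((i, b) :: w) =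
    (\pi_presg [:: (i, b)] : presg) * \pi_presg w.
  by rewrite [RHS]pres_mulE.
rewrite gM hM IHw; congr mul.
by case: b; rewrite -?pgenV ?morphgV ?gh.
Qed.

End Presentation.

Definition free_group (n : nat) : groupType :=
  presg (fun _ _ : word 'I_n => False).

(* sigma_1, ..., sigma_(n-1) are indexed here by 0, ..., n-2 *)
Inductive braid_rel (n : nat) : word 'I_n.-1 -> word 'I_n.-1 -> Prop :=
| braid_far (i j : 'I_n.-1) of (i.+1 < j) || (j.+1 < i) :
    braid_rel [:: (i, false); (j, false)] [:: (j, false); (i, false)]
| braid_near (i j : 'I_n.-1) of j = i.+1 :> nat :
    braid_rel [:: (i, false); (j, false); (i, false)]
              [:: (j, false); (i, false); (j, false)].

Definition braid_group (n : nat) : groupType := presg (@braid_rel n).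

Section BraidPermutation.
Local Open Scope group_scope.
Variable n : nat.

Definition braid_letter_perm (i : 'I_n.-1) : 'S_n :=
  let k := widen_ord (leq_pred n) i in tperm k (ordS k).

Definition braid_perm : braid_group n -> 'S_n := pres_lift braid_letter_perm.

Fact tperm_far (T : finType) (a b c d : T) :
    a != c -> a != d -> b != c -> b != d ->
  tperm a b * tperm c d = tperm c d * tperm a b.
Proof.
move=> ac ad bc bd; rewrite [LHS]conjgC; congr mul.
by rewrite tpermJ !tpermD// eq_sym.
Qed.

Fact tperm_near (T : finType) (a b c : T) :
    a != b -> a != c -> b != c ->
  tperm a b * (tperm b c * tperm a b) = tperm b c * (tperm a b * tperm b c).
Proof.
move=> ab ac bc; rewrite -{1}(tpermV a b) -{2}(tpermV b c).
rewrite -![_^-1 * _]/(conjg _ _) !tpermJ !tpermR !tpermL.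
by rewrite !tpermD// eq_sym.
Qed.

Fact braid_perm_rel u v : braid_rel u v ->
  word_val braid_letter_perm u = word_val braid_letter_perm v.
Proof.
have ordSE (i : 'I_n.-1) : val (ordS (widen_ord (leq_pred n) i)) = i.+1.
  by rewrite /= modn_small// -ltn_predRL.
case=> i j ij; rewrite /word_val !big_cons big_nil /letter_val/= !mulg1.
  by apply: tperm_far; rewrite -(inj_eq val_inj) ?ordSE /=; lia.
rewrite /braid_letter_perm.
have <- : widen_ord (leq_pred n) j = ordS (widen_ord (leq_pred n) i).
  by apply: val_inj; rewrite ordSE.
by apply: tperm_near; rewrite -(inj_eq val_inj) ?ordSE /=; lia.
Qed.

Fact braid_perm1 : braid_perm 1 = 1.
Proof. exact/pres_lift1/braid_perm_rel. Qed.
Fact braid_permM : {morph braid_perm : x y / x * y}.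
Proof. exact/pres_liftM/braid_perm_rel. Qed.

HB.instance Definition _ :=
  isMultiplicative.Build (braid_group n) 'S_n braid_perm braid_permM.
HB.instance Definition _ :=
  Multiplicative_isUMagmaMorphism.Build (braid_group n) 'S_n braid_perm
    braid_perm1.

Definition pure_braid_group : groupType := subgroup_type (gker braid_perm).

End BraidPermutation.

Definition Pi_group (n : nat) : groupType :=
  dprodg (fun i : 'I_n.-1 => free_group i.+1).

Section UpperMcCool.
Local Open Scope group_scope.
Variable n : nat.

Let x (k : 'I_n) : free_group n := pgen _ k.

Definition mccool_fun (i j : 'I_n) : free_group n -> free_group n :=
  pres_lift (fun k => if k == i then x j * x i * (x j)^-1 else x k).
Definition mccool_funV (i j : 'I_n) : free_group n -> free_group n :=
  pres_lift (fun k => if k == i then (x j)^-1 * x i * x j else x k).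

Fact mccool_funM i j : {morph mccool_fun i j : u v / u * v}.
Proof. exact/pres_liftM. Qed.
Fact mccool_funVM i j : {morph mccool_funV i j : u v / u * v}.
Proof. exact/pres_liftM. Qed.

Fact mccool_fun_gen i j k :
  mccool_fun i j (x k) = if k == i then x j * x i * (x j)^-1 else x k.
Proof. exact: pres_lift_gen. Qed.
Fact mccool_funV_gen i j k :
  mccool_funV i j (x k) = if k == i then (x j)^-1 * x i * x j else x k.
Proof. exact: pres_lift_gen. Qed.

Fact mccool_funK i j : j != i -> cancel (mccool_fun i j) (mccool_funV i j).
Proof.
move=> /negbTE ji; apply: (pres_ext (g := mccool_funV i j \o mccool_fun i j)).
- by move=> u v /=; rewrite mccool_funM mccool_funVM.
- by [].
move=> k /=; rewrite mccool_fun_gen.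
case: eqP => [->|/eqP/negbTE ki]; last first.
  by rewrite mccool_funV_gen ki.
rewrite !mccool_funVM (morphgV (@mccool_funVM i j)) !mccool_funV_gen ji eqxx.
by rewrite -!mulgA mulgV mulg1 mulVKg.
Qed.

Fact mccool_funVK i j : j != i -> cancel (mccool_funV i j) (mccool_fun i j).
Proof.
move=> /negbTE ji; apply: (pres_ext (g := mccool_fun i j \o mccool_funV i j)).
- by move=> u v /=; rewrite mccool_funVM mccool_funM.
- by [].
move=> k /=; rewrite mccool_funV_gen.
case: eqP => [->|/eqP/negbTE ki]; last first.
  by rewrite mccool_fun_gen ki.
rewrite !mccool_funM (morphgV (@mccool_funM i j)) !mccool_fun_gen ji eqxx.
by rewrite -!mulgA mulVg mulg1 mulKg.
Qed.

(* alpha_ij : x_i |-> x_j x_i x_j^-1 and x_k |-> x_k for k != i *)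
Definition mccool (i j : 'I_n) (ji : j != i) : autg (free_group n) :=
  Autg (@mccool_funM i j) (mccool_funK ji) (mccool_funVK ji).

Inductive upper_mccool_gen : autg (free_group n) -> Prop :=
| UpperMcCoolGen (i j : 'I_n) (ji : j != i) of j < i :
    upper_mccool_gen (mccool ji).

Definition upper_mccool_group : groupType :=
  subgroup_type (gen upper_mccool_gen).

End UpperMcCool.

Section LowerCentralSeries.
Local Open Scope group_scope.
Variable G : groupType.

Inductive commutator_with (A : {pred G}) : G -> Prop :=
| CommutatorWith x y of x \in A : commutator_with A [~ x, y].

Fixpoint lcs_rec (k : nat) : {pred G} :=
  if k is k'.+1 then gen (commutator_with (lcs_rec k')) else predT.

(* lcs k is Gamma_k G for k >= 1; as for the finite groups of MathComp,
   lcs 0 = lcs 1 = G *)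
Definition lcs (k : nat) : {pred G} := lcs_rec k.-1.

Fact lcs_mulM k : mulg_closed (lcs k).
Proof. by case: k => [|[|k]] // x y; apply: gpredM. Qed.
Fact lcs_mul1 k : 1 \in lcs k.
Proof. by case: k => [|[|k]] //; apply: gpred1. Qed.
Fact lcs_mulV k : invg_closed (lcs k).
Proof. by case: k => [|[|k]] // x; apply: gpredVr. Qed.

HB.instance Definition _ k := isMulClosed.Build G (lcs k) (@lcs_mulM k).
HB.instance Definition _ k := isMul1Closed.Build G (lcs k) (lcs_mul1 k).
HB.instance Definition _ k := isInvClosed.Build G (lcs k) (@lcs_mulV k).

Lemma lcsR1 k x y : x \in lcs k -> [~ x, y] \in lcs k.+1.
Proof. by case: k => // k xk; apply/genP/gen_in. Qed.

Lemma gen_ind (A P : G -> Prop) :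
  (forall x, A x -> P x) -> P 1 -> (forall x y, P x -> P y -> P (x * y)) ->
  (forall x, P x -> P x^-1) -> forall x, x \in gen A -> P x.
Proof. by move=> AP P1 PM PV x /genP; elim=> *; auto. Qed.

Lemma lcsS k : {subset lcs k.+1 <= lcs k}.
Proof.
case: k => [//|k]; elim: k => [//|k IHk].
move=> x /genP xk; apply/genP; elim: xk => {x} [_ [x y xk]|||].
- exact/gen_in/CommutatorWith/IHk.
- exact: gen_one.
- by move=> *; exact: gen_mul.
- by move=> *; exact: gen_inv.
Qed.

Lemma lcsJ k x y : x \in lcs k -> x ^ y \in lcs k.
Proof.
move=> xk; rewrite -[x ^ y](mulKVg x) -/(commg x y).
by apply: gpredM => //; apply/lcsS/lcsR1.
Qed.

Lemma hall_witt (x y z : G) :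
  [~ x, y^-1, z] ^ y * [~ y, z^-1, x] ^ z * [~ z, x^-1, y] ^ x = 1.
Proof.
rewrite /commg /conjg !(invgM, invgK, mulgA).
by do !rewrite ?mulgK ?mulgVK ?mulgV ?mulVg ?mul1g.
Qed.

Lemma commgMr (x y z : G) : [~ x, y * z] = [~ x, z] * [~ x, y] ^ z.
Proof.
rewrite /commg /conjg !(invgM, invgK, mulgA).
by do !rewrite ?mulgK ?mulgVK ?mulgV ?mulVg ?mul1g.
Qed.

Lemma commgMl (x y z : G) : [~ x * y, z] = [~ x, z] ^ y * [~ y, z].
Proof.
rewrite /commg /conjg !(invgM, invgK, mulgA).
by do !rewrite ?mulgK ?mulgVK ?mulgV ?mulVg ?mul1g.
Qed.

Lemma lcsR i j x y : x \in lcs i -> y \in lcs j -> [~ x, y] \in lcs (i + j).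
Proof.
case: j => [|j]; first by move=> xi _; rewrite addn0; apply/lcsS/lcsR1.
elim: j i x y => [|j IHj] i x y xi yj; first by rewrite addn1; exact: lcsR1.
move: y yj; apply: gen_ind.
- move=> _ [a b aj]; rewrite -invgR; apply: gpredVr.
  rewrite -[X in X \in _](conjgKV b); apply: lcsJ.
  have /eqP := hall_witt a b^-1 x; rewrite invgK -mulgA mulg_eq1 => /eqP->.
  apply/gpredVr/gpredM; apply: lcsJ.
    rewrite -[(i + _)%N]addSnnS; apply: IHj => //.
    by rewrite -invgR; apply/gpredVr/lcsR1/gpredVr.
  by rewrite addnS; apply/lcsR1/IHj => //; exact: gpredVr.
- by rewrite commg1; exact: gpred1.
- by move=> y z xy xz; rewrite commgMr; apply: gpredM => //; exact: lcsJ.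
move=> y xy; have /eqP := commgMr x y y^-1.
rewrite mulgV commg1 eq_sym mulg_eq1 => /eqP->.
exact/gpredVr/lcsJ.
Qed.

Definition lcs_eq k x y := x^-1 * y \in lcs k.

Lemma lcs_eq_refl k : reflexive (lcs_eq k).
Proof. by move=> x; rewrite /lcs_eq mulVg gpred1. Qed.
Lemma lcs_eq_sym k : symmetric (lcs_eq k).
Proof. by move=> x y; rewrite /lcs_eq -gpredV invgM invgK. Qed.
Lemma lcs_eq_trans k : transitive (lcs_eq k).
Proof.
by move=> y x z xy yz; rewrite /lcs_eq -(mulgK y x^-1) -mulgA gpredM.
Qed.
Lemma lcs_eqM k x x' y y' :
  lcs_eq k x x' -> lcs_eq k y y' -> lcs_eq k (x * y) (x' * y').
Proof.
rewrite /lcs_eq => xx' yy'.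
have -> : (x * y)^-1 * (x' * y') = (x^-1 * x') ^ y * (y^-1 * y').
  by rewrite /conjg invgM !mulgA mulgK.
by rewrite gpredM ?lcsJ.
Qed.
Lemma lcs_eqV k x x' : lcs_eq k x x' -> lcs_eq k x^-1 x'^-1.
Proof.
rewrite lcs_eq_sym /lcs_eq => xx'.
have -> : x^-1^-1 * x'^-1 = (x'^-1 * x) ^ x^-1 by rewrite /conjg mulgK.
exact: lcsJ.
Qed.
Lemma lcs_eqJ k x y : x \in lcs k -> lcs_eq k.+1 x (x ^ y).
Proof. exact: lcsR1. Qed.
Lemma lcs_eq1 k x : lcs_eq k 1 x = (x \in lcs k).
Proof. by rewrite /lcs_eq invg1 mul1g. Qed.

Lemma lcs_eqRl i j x x' y : x \in lcs i -> y \in lcs j ->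
  lcs_eq (i + j).+1 [~ x * x', y] ([~ x, y] * [~ x', y]).
Proof.
move=> xi yj; rewrite commgMl; apply: lcs_eqM; last exact: lcs_eq_refl.
by rewrite lcs_eq_sym; apply/lcs_eqJ/lcsR.
Qed.

Lemma lcs_eqRr i j x y y' : x \in lcs i -> y \in lcs j ->
  lcs_eq (i + j).+1 [~ x, y * y'] ([~ x, y'] * [~ x, y]).
Proof.
move=> xi yj; rewrite commgMr; apply: lcs_eqM; first exact: lcs_eq_refl.
by rewrite lcs_eq_sym; apply/lcs_eqJ/lcsR.
Qed.

End LowerCentralSeries.

Arguments lcs : clear implicits.
Arguments lcs_eq : clear implicits.

Section LcsQuotient.
Local Open Scope group_scope.
Local Open Scope quotient_scope.
Variables (G : groupType) (k : nat).

Notation L := (subgroup_type (lcs G k)).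
Implicit Types u v w : L.

Definition lcs_quo_eq : rel L := fun u v => lcs_eq G k.+1 (val u) (val v).

Fact lcs_quo_eq_refl : reflexive lcs_quo_eq.
Proof. by move=> u; exact: lcs_eq_refl. Qed.
Fact lcs_quo_eq_sym : symmetric lcs_quo_eq.
Proof. by move=> u v; exact: lcs_eq_sym. Qed.
Fact lcs_quo_eq_trans : transitive lcs_quo_eq.
Proof. by move=> v u w; exact: lcs_eq_trans. Qed.

Canonical lcs_quo_equiv := EquivRel lcs_quo_eq lcs_quo_eq_refl
  lcs_quo_eq_sym lcs_quo_eq_trans.

(* Gamma_k G / Gamma_(k+1) G, written additively *)
Definition lcs_quo := {eq_quot lcs_quo_equiv}.

HB.instance Definition _ := Choice.on lcs_quo.
HB.instance Definition _ := Quotient.on lcs_quo.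
HB.instance Definition _ := EqQuotient.on lcs_quo.

Lemma lcs_quoP u v : \pi_lcs_quo u = \pi_lcs_quo v <-> lcs_quo_eq u v.
Proof. by split=> [/(eqquotP lcs_quo)|uv] //; apply/(eqquotP lcs_quo). Qed.

Lemma lcs_quo_repr u : lcs_quo_eq (repr (\pi_lcs_quo u)) u.
Proof. by apply/lcs_quoP; rewrite reprK. Qed.

Definition lcs_quo0 : lcs_quo := \pi_lcs_quo 1.
Definition lcs_quo_opp (a : lcs_quo) : lcs_quo := \pi_lcs_quo (repr a)^-1.
Definition lcs_quo_add (a b : lcs_quo) : lcs_quo :=
  \pi_lcs_quo (repr a * repr b).

Lemma lcs_quo_oppE u : lcs_quo_opp (\pi_lcs_quo u) = \pi_lcs_quo u^-1.
Proof. by apply/lcs_quoP; exact: lcs_eqV (lcs_quo_repr u). Qed.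

Lemma lcs_quo_addE u v :
  lcs_quo_add (\pi_lcs_quo u) (\pi_lcs_quo v) = \pi_lcs_quo (u * v).
Proof.
by apply/lcs_quoP; exact: lcs_eqM (lcs_quo_repr u) (lcs_quo_repr v).
Qed.

Fact lcs_quo_addA : associative lcs_quo_add.
Proof.
elim/quotW=> u; elim/quotW=> v; elim/quotW=> w.
by rewrite (lcs_quo_addE v w) (lcs_quo_addE u v) !lcs_quo_addE mulgA.
Qed.
Fact lcs_quo_addC : commutative lcs_quo_add.
Proof.
elim/quotW=> u; elim/quotW=> v; rewrite (lcs_quo_addE u v) lcs_quo_addE.
apply/lcs_quoP; rewrite lcs_quo_eq_sym /lcs_quo_eq /lcs_eq !valM.
by rewrite invgM -mulgA; apply/lcsR1/valP.
Qed.
Fact lcs_quo_add0 : left_id lcs_quo0 lcs_quo_add.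
Proof. by elim/quotW=> u; rewrite lcs_quo_addE mul1g. Qed.
Fact lcs_quo_addN : left_inverse lcs_quo0 lcs_quo_opp lcs_quo_add.
Proof. by elim/quotW=> u; rewrite lcs_quo_oppE lcs_quo_addE mulVg. Qed.

HB.instance Definition _ := GRing.isZmodule.Build lcs_quo
  lcs_quo_addA lcs_quo_addC lcs_quo_add0 lcs_quo_addN.

Lemma pi_lcs_quoM u v :
  \pi_lcs_quo (u * v) = (\pi_lcs_quo u + \pi_lcs_quo v)%R.
Proof. exact/esym/lcs_quo_addE. Qed.
Lemma pi_lcs_quoV u : \pi_lcs_quo u^-1 = (- \pi_lcs_quo u)%R.
Proof. exact/esym/lcs_quo_oppE. Qed.
Lemma pi_lcs_quo1 : \pi_lcs_quo 1 = 0%R.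
Proof. by []. Qed.

End LcsQuotient.

Section LcsBracket.
Local Open Scope group_scope.
Local Open Scope quotient_scope.
Variables (G : groupType).
Notation L k := (subgroup_type (lcs G k)).
Notation Q k := (lcs_quo G k).

Definition lcs_comm i j (u : L i) (v : L j) : L (i + j) :=
  Subg (lcsR (valP u) (valP v)).

Definition lcs_br i j (a : Q i) (b : Q j) : Q (i + j) :=
  \pi_(Q (i + j)) (lcs_comm (repr a) (repr b)).

Lemma lcs_brE i j (u : L i) (v : L j) :
  lcs_br (\pi_(Q i) u) (\pi_(Q j) v) = \pi_(Q (i + j)) (lcs_comm u v).
Proof.
apply/lcs_quoP; rewrite lcs_quo_eq_sym /lcs_quo_eq /=.
have := lcs_quo_repr u; have := lcs_quo_repr v.
rewrite ![lcs_quo_eq (repr _) _]lcs_quo_eq_sym /lcs_quo_eq.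
move: (repr _) => v'; move: (repr _) => u'; rewrite /lcs_eq => vv' uu'.
rewrite -(mulVKg (val u) (val u')) -(mulVKg (val v) (val v')).
move: (_ * _) uu' (_ * _) vv' => w uw t vt.
rewrite -/(lcs_eq G _ _ _) lcs_eq_sym.
apply: (@lcs_eq_trans _ _ [~ val u, val v * t]).
  apply: lcs_eq_trans.
    by apply: lcs_eqRl; [exact: valP | apply: gpredM (lcsS vt); exact: valP].
  rewrite -[X in lcs_eq _ _ _ X]mulg1; apply: lcs_eqM; first exact: lcs_eq_refl.
  rewrite lcs_eq_sym lcs_eq1 -addSn; apply: lcsR => //.
  by apply: gpredM (lcsS vt); exact: valP.
apply: lcs_eq_trans; first by apply: lcs_eqRr; exact: valP.
rewrite -[X in lcs_eq _ _ _ X]mul1g; apply: lcs_eqM; last exact: lcs_eq_refl.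
by rewrite lcs_eq_sym lcs_eq1 -addnS; apply: lcsR => //; exact: valP.
Qed.

Local Open Scope ring_scope.

Lemma lcs_brDl i j (a a' : Q i) (b : Q j) :
  lcs_br (a + a') b = lcs_br a b + lcs_br a' b.
Proof.
elim/quotW: a => u; elim/quotW: a' => u'; elim/quotW: b => v.
rewrite -pi_lcs_quoM !lcs_brE -pi_lcs_quoM; apply/lcs_quoP.
by apply: lcs_eqRl; exact: valP.
Qed.

Lemma lcs_brDr i j (a : Q i) (b b' : Q j) :
  lcs_br a (b + b') = lcs_br a b + lcs_br a b'.
Proof.
elim/quotW: a => u; elim/quotW: b => v; elim/quotW: b' => v'.
rewrite -pi_lcs_quoM !lcs_brE addrC -pi_lcs_quoM; apply/lcs_quoP.
by apply: lcs_eqRr; exact: valP.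
Qed.

Lemma lcs_brNl i j (a : Q i) (b : Q j) : lcs_br (- a) b = - lcs_br a b.
Proof.
have br0 : lcs_br 0 b = 0 :> Q (i + j).
  by apply: (@addrI _ (lcs_br 0 b)); rewrite -lcs_brDl !addr0.
by apply/eqP; rewrite -addr_eq0 -lcs_brDl addNr br0.
Qed.

Lemma lcs_brNr i j (a : Q i) (b : Q j) : lcs_br a (- b) = - lcs_br a b.
Proof.
have br0 : lcs_br a 0 = 0 :> Q (i + j).
  by apply: (@addrI _ (lcs_br a 0)); rewrite -lcs_brDr !addr0.
by apply/eqP; rewrite -addr_eq0 -lcs_brDr addNr br0.
Qed.

Lemma lcs_brxx i (a : Q i) : lcs_br a a = 0.
Proof.
elim/quotW: a => u; rewrite lcs_brE; apply/lcs_quoP.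
by rewrite /lcs_quo_eq /= commgg lcs_eq_refl.
Qed.

Lemma lcs_quo_cast i j (e : i = j) (u : L i) (v : L j) : val u = val v ->
  ecast k (Q k) e (\pi_(Q i) u) = \pi_(Q j) v.
Proof. by case: j / e v => v /val_inj ->. Qed.

Lemma lcs_brC i j (e : (i + j = j + i)%N) (a : Q i) (b : Q j) :
  lcs_br b a = - ecast k (Q k) e (lcs_br a b).
Proof.
elim/quotW: a => u; elim/quotW: b => v; rewrite !lcs_brE.
have uvL : [~ val u, val v]%g \in lcs G (j + i).
  by rewrite -e; exact: lcsR (valP u) (valP v).
rewrite (@lcs_quo_cast _ _ e _ (Subg uvL))//  -pi_lcs_quoV.
by congr (\pi_(Q _) _); apply: val_inj; rewrite /= -invgR.
Qed.

Lemma lcs_br3E i j k (u : L i) (v : L j) (w : L k) :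
  lcs_br (lcs_br (\pi_(Q i) u) (\pi_(Q j) v)) (\pi_(Q k) w)
  = \pi_(Q (i + j + k)) (lcs_comm (lcs_comm u v^-1%g) w)^-1%g.
Proof.
rewrite -[\pi_(Q j) v]opprK -(pi_lcs_quoV v) lcs_brNr lcs_brNl.
by rewrite (lcs_brE u) lcs_brE -pi_lcs_quoV.
Qed.

Lemma lcs_jacobi i j k (e1 : (j + k + i = i + j + k)%N)
    (e2 : (k + i + j = i + j + k)%N) (a : Q i) (b : Q j) (c : Q k) :
  lcs_br (lcs_br a b) c + ecast m (Q m) e1 (lcs_br (lcs_br b c) a)
    + ecast m (Q m) e2 (lcs_br (lcs_br c a) b) = 0.
Proof.
elim/quotW: a => u; elim/quotW: b => v; elim/quotW: c => w.
have HW := hall_witt (val u) (val v) (val w).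
rewrite !lcs_br3E.
set x := lcs_comm _ w; set y := lcs_comm _ u; set z := lcs_comm _ v.
have yL : val y \in lcs G (i + j + k) by rewrite -e1; exact: valP.
have zL : val z \in lcs G (i + j + k) by rewrite -e2; exact: valP.
rewrite (@lcs_quo_cast _ _ e1 _ (Subg yL)^-1%g)//.
rewrite (@lcs_quo_cast _ _ e2 _ (Subg zL)^-1%g)//.
rewrite addrC [X in _ + X]addrC -(pi_lcs_quoM (Subg yL)^-1%g) -pi_lcs_quoM.
rewrite -invgM -invgM.
rewrite -[RHS]/(\pi_(Q (i + j + k)) 1%g); apply/lcs_quoP.
rewrite /lcs_quo_eq lcs_eq_sym lcs_eq1; apply: gpredVr.
rewrite -lcs_eq1 -HW lcs_eq_sym.
by apply: lcs_eqM; [apply: lcs_eqM|]; apply: lcs_eqJ => //; exact: (valP x).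
Qed.

End LcsBracket.

Section Tensor.
Local Open Scope ring_scope.
Local Open Scope quotient_scope.
Variables (K : fieldType) (A : zmodType).

(* the sequence [:: (c_1, a_1); ...; (c_n, a_n)] stands for the tensor
   c_1 (x) a_1 + ... + c_n (x) a_n *)
Notation fsum := (seq (K * A)).
Implicit Types u v w : fsum.

Inductive tensor_eq : fsum -> fsum -> Prop :=
| tensor_refl u : tensor_eq u u
| tensor_sym u v of tensor_eq u v : tensor_eq v u
| tensor_trans u v w of tensor_eq u v & tensor_eq v w : tensor_eq u w
| tensor_cat u u' v v' of tensor_eq u u' & tensor_eq v v' :
    tensor_eq (u ++ v) (u' ++ v')
| tensor_catC u v : tensor_eq (u ++ v) (v ++ u)
| tensor_0l a : tensor_eq [:: (0, a)] [::]
| tensor_Dl c d a : tensor_eq [:: (c + d, a)] [:: (c, a); (d, a)]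
| tensor_Dr c a b : tensor_eq [:: (c, a + b)] [:: (c, a); (c, b)].

Definition tensor_eqb u v := `[< tensor_eq u v >].

Fact tensor_eqb_refl : reflexive tensor_eqb.
Proof. by move=> w; apply/asboolP; exact: tensor_refl. Qed.
Fact tensor_eqb_sym : symmetric tensor_eqb.
Proof. by move=> u v; apply/asboolP/asboolP => ?; exact: tensor_sym. Qed.
Fact tensor_eqb_trans : transitive tensor_eqb.
Proof.
by move=> v u w /asboolP uv /asboolP vw; apply/asboolP; exact: tensor_trans vw.
Qed.

Canonical tensor_equiv := EquivRel tensor_eqb tensor_eqb_refl tensor_eqb_sym
  tensor_eqb_trans.

Definition tensor := {eq_quot tensor_equiv}.

HB.instance Definition _ := Choice.on tensor.
HB.instance Definition _ := Quotient.on tensor.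
HB.instance Definition _ := EqQuotient.on tensor.

Lemma tensorP u v : \pi_tensor u = \pi_tensor v <-> tensor_eq u v.
Proof.
by split=> [/(eqquotP tensor)/asboolP//|uv]; apply/(eqquotP tensor)/asboolP.
Qed.

Lemma tensor_repr u : tensor_eq (repr (\pi_tensor u)) u.
Proof. by apply/tensorP; rewrite reprK. Qed.

Definition fsum_scale (c : K) u : fsum := [seq (c * p.1, p.2) | p <- u].

Lemma fsum_scaleP c u v :
  tensor_eq u v -> tensor_eq (fsum_scale c u) (fsum_scale c v).
Proof.
elim=> {u v} [u|u v _|u v w _ uv _|u u' v v' _ uu' _ vv'|u v|a|d e a|d a b] /=.
- exact: tensor_refl.
- exact: tensor_sym.
- exact: tensor_trans.
- by rewrite /fsum_scale !map_cat; exact: tensor_cat.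
- by rewrite /fsum_scale !map_cat; exact: tensor_catC.
- by rewrite mulr0; exact: tensor_0l.
- by rewrite mulrDr; exact: tensor_Dl.
- exact: tensor_Dr.
Qed.

Definition tensor0 : tensor := \pi_tensor [::].
Definition tensor_add (s t : tensor) : tensor := \pi_tensor (repr s ++ repr t).
Definition tensor_scale (c : K) (t : tensor) : tensor :=
  \pi_tensor (fsum_scale c (repr t)).
Definition tensor_opp : tensor -> tensor := tensor_scale (-1).

Lemma tensor_addE u v :
  tensor_add (\pi_tensor u) (\pi_tensor v) = \pi_tensor (u ++ v).
Proof. by apply/tensorP; apply: tensor_cat; exact: tensor_repr. Qed.

Lemma tensor_scaleE c u :
  tensor_scale c (\pi_tensor u) = \pi_tensor (fsum_scale c u).
Proof. by apply/tensorP; apply: fsum_scaleP; exact: tensor_repr. Qed.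

Fact tensor_addA : associative tensor_add.
Proof.
elim/quotW=> u; elim/quotW=> v; elim/quotW=> w.
by rewrite (tensor_addE v w) (tensor_addE u v) !tensor_addE catA.
Qed.
Fact tensor_addC : commutative tensor_add.
Proof.
elim/quotW=> u; elim/quotW=> v; rewrite (tensor_addE u v) tensor_addE.
by apply/tensorP; exact: tensor_catC.
Qed.
Fact tensor_add0 : left_id tensor0 tensor_add.
Proof. by elim/quotW=> u; rewrite tensor_addE. Qed.
Fact tensor_scaleDl t :
  {morph tensor_scale^~ t : c d / c + d >-> tensor_add c d}.
Proof.
elim/quotW: t => u c d; rewrite !tensor_scaleE tensor_addE; apply/tensorP.
elim: u => [|[e a] u IHu] /=; first exact: tensor_refl.
apply: (@tensor_trans _ ([:: (c * e, a)] ++ ([:: (d * e, a)] ++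
  (fsum_scale c u ++ fsum_scale d u)))).
  rewrite catA -cat1s; apply: tensor_cat => //.
  by rewrite mulrDl; exact: tensor_Dl.
rewrite -[X in tensor_eq _ X]cat1s; apply: tensor_cat; first exact: tensor_refl.
rewrite -[X in tensor_eq _ (_ ++ X)]cat1s !catA.
by apply: tensor_cat; [exact: tensor_catC | exact: tensor_refl].
Qed.
Fact tensor_scale1 : left_id 1 tensor_scale.
Proof.
elim/quotW=> u; rewrite tensor_scaleE; congr (\pi_tensor _).
by rewrite /fsum_scale map_id_in // => -[c a] _ /=; rewrite mul1r.
Qed.
Fact tensor_scale0 t : tensor_scale 0 t = tensor0.
Proof.
elim/quotW: t => u; rewrite tensor_scaleE; apply/tensorP.
elim: u => [|[e a] u IHu] /=; first exact: tensor_refl.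
rewrite mul0r -cat1s -[X in tensor_eq _ X]cats0.
by apply: tensor_cat => //; exact: tensor_0l.
Qed.
Fact tensor_addN : left_inverse tensor0 tensor_opp tensor_add.
Proof.
move=> t; rewrite -{2}[t]tensor_scale1 -tensor_scaleDl addNr.
exact: tensor_scale0.
Qed.

HB.instance Definition _ := GRing.isZmodule.Build tensor
  tensor_addA tensor_addC tensor_add0 tensor_addN.

Fact tensor_scaleA c d t :
  tensor_scale c (tensor_scale d t) = tensor_scale (c * d) t.
Proof.
elim/quotW: t => u; rewrite (tensor_scaleE d u) !tensor_scaleE.
congr (\pi_tensor _); rewrite /fsum_scale -map_comp; apply: eq_map => -[e a] /=.
by rewrite mulrA.
Qed.
Fact tensor_scaleDr : right_distributive tensor_scale +%R.
Proof.
move=> c; elim/quotW=> u; elim/quotW=> v.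
rewrite [\pi_tensor u + _]tensor_addE !tensor_scaleE [RHS]tensor_addE.
by rewrite /fsum_scale map_cat.
Qed.

HB.instance Definition _ := GRing.Zmodule_isLmodule.Build K tensor
  tensor_scaleA tensor_scale1 tensor_scaleDr tensor_scaleDl.

Definition ptensor (c : K) (a : A) : tensor := \pi_tensor [:: (c, a)].

Lemma ptensorDl c d a : ptensor (c + d) a = ptensor c a + ptensor d a.
Proof.
by rewrite [RHS]tensor_addE; apply/tensorP; exact: tensor_Dl.
Qed.
Lemma ptensorDr c a b : ptensor c (a + b) = ptensor c a + ptensor c b.
Proof.
by rewrite [RHS]tensor_addE; apply/tensorP; exact: tensor_Dr.
Qed.
Lemma ptensorZ c d a : c *: ptensor d a = ptensor (c * d) a.
Proof. exact: tensor_scaleE. Qed.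
Lemma ptensor0r c : ptensor c 0 = 0.
Proof. by apply: (@addrI _ (ptensor c 0)); rewrite -ptensorDr !addr0. Qed.
Lemma ptensorNr c a : ptensor c (- a) = - ptensor c a.
Proof. by apply/eqP; rewrite -addr_eq0 -ptensorDr addNr ptensor0r. Qed.

Lemma pi_tensorE u : \pi_tensor u = \sum_(p <- u) ptensor p.1 p.2.
Proof.
elim: u => [|[c a] u IHu]; first by rewrite big_nil.
by rewrite big_cons -IHu [RHS]tensor_addE.
Qed.

Lemma tensor_ind (P : tensor -> Prop) :
  P 0 -> (forall s t, P s -> P t -> P (s + t)) ->
  (forall c a, P (ptensor c a)) -> forall t, P t.
Proof.
by move=> P0 PD Pp; elim/quotW=> u; rewrite pi_tensorE; elim/big_ind: _.
Qed.

Section Lift.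
Variables (M : lmodType K) (f : A -> M).

Definition tensor_lift (t : tensor) : M := \sum_(p <- repr t) p.1 *: f p.2.

Hypothesis fD : {morph f : a b / a + b}.

Lemma tensor_lift_eq u v : tensor_eq u v ->
  \sum_(p <- u) p.1 *: f p.2 = \sum_(p <- v) p.1 *: f p.2.
Proof.
elim=> {u v} //.
- by move=> u v w _ -> _.
- by move=> u u' v v' _ uu' _ vv'; rewrite !big_cat uu' vv'.
- by move=> u v; rewrite !big_cat; exact: addrC.
- by move=> a; rewrite big_seq1 big_nil scale0r.
- by move=> c d a; rewrite big_seq1 big_cons big_seq1 scalerDl.
- by move=> c a b; rewrite big_seq1 big_cons big_seq1 fD scalerDr.
Qed.

Lemma tensor_liftE u : tensor_lift (\pi_tensor u) = \sum_(p <- u) p.1 *: f p.2.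
Proof. exact/tensor_lift_eq/tensor_repr. Qed.

Lemma tensor_lift_pure c a : tensor_lift (ptensor c a) = c *: f a.
Proof. by rewrite tensor_liftE big_seq1. Qed.

Lemma tensor_liftD : {morph tensor_lift : s t / s + t}.
Proof.
elim/quotW=> u; elim/quotW=> v.
by rewrite [\pi_tensor u + _]tensor_addE !tensor_liftE big_cat.
Qed.

Lemma tensor_liftZ c : {morph tensor_lift : t / c *: t}.
Proof.
elim/quotW=> u; rewrite [c *: _]tensor_scaleE !tensor_liftE /fsum_scale big_map.
by rewrite scaler_sumr; apply: eq_bigr => p _ /=; rewrite scalerA.
Qed.

End Lift.

End Tensor.

(* The graded Lie algebra is the direct sum of its pieces, and the axioms are
   stated on homogeneous elements; ecast transports along an equality of
   degrees. The degree 0 piece of gr G K below is 0. *)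
Record graded_lie (K : fieldType) := GradedLie {
  gl_piece :> nat -> lmodType K;
  gl_br : forall i j, gl_piece i -> gl_piece j -> gl_piece (i + j)%N;
  gl_br_linearl : forall i j (c : K) (x x' : gl_piece i) (y : gl_piece j),
    (gl_br (c *: x + x') y = c *: gl_br x y + gl_br x' y)%R;
  gl_br_linearr : forall i j (c : K) (x : gl_piece i) (y y' : gl_piece j),
    (gl_br x (c *: y + y') = c *: gl_br x y + gl_br x y')%R;
  gl_brxx : forall i (x : gl_piece i), gl_br x x = 0%R;
  gl_brC : forall i j (e : (i + j = j + i)%N) (x : gl_piece i) (y : gl_piece j),
    (gl_br y x = - ecast m (gl_piece m) e (gl_br x y))%R;
  gl_jacobi : forall i j k
    (e1 : (j + k + i = i + j + k)%N) (e2 : (k + i + j = i + j + k)%N)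
    (x : gl_piece i) (y : gl_piece j) (z : gl_piece k),
    (gl_br (gl_br x y) z + ecast m (gl_piece m) e1 (gl_br (gl_br y z) x)
      + ecast m (gl_piece m) e2 (gl_br (gl_br z x) y) = 0)%R }.

Definition graded_lie_iso (K : fieldType) (L M : graded_lie K) : Prop :=
  exists f : forall k, {linear L k -> M k},
    (forall k, bijective (f k)) /\
    (forall i j (x : L i) (y : L j),
      f (i + j)%N (gl_br x y) = gl_br (f i x) (f j y)).

Section AssociatedGraded.
Local Open Scope ring_scope.
Variables (G : groupType) (K : fieldType).

Definition gr_piece (k : nat) : lmodType K := tensor K (lcs_quo G k).

Definition gr_br i j (s : gr_piece i) (t : gr_piece j) : gr_piece (i + j) :=
  tensor_lift (fun a => tensor_lift (fun b => ptensor 1 (lcs_br a b)) t) s.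

Let gr_inner i j (t : gr_piece j) (a : lcs_quo G i) : gr_piece (i + j) :=
  tensor_lift (fun b => ptensor 1 (lcs_br a b)) t.

Fact gr_inner_fD i j (a : lcs_quo G i) :
  {morph (fun b : lcs_quo G j => ptensor (1 : K) (lcs_br a b)) : b b' / b + b'}.
Proof. by move=> b b'; rewrite lcs_brDr ptensorDr. Qed.

Fact gr_innerD i j (t : gr_piece j) : {morph @gr_inner i j t : a b / a + b}.
Proof.
move=> a a'; rewrite /gr_inner; elim/tensor_ind: t => [|s t IHs IHt|c b].
- have lift0 a0 : tensor_lift (fun b : lcs_quo G j =>
      ptensor (1 : K) (lcs_br (a0 : lcs_quo G i) b)) 0 = 0.
    rewrite -[0 in LHS](scale0r 0) tensor_liftZ ?scale0r//.
    exact: gr_inner_fD.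
  by rewrite !lift0 addr0.
- by rewrite !tensor_liftD ?IHs ?IHt 1?addrACA//; exact: gr_inner_fD.
- rewrite !tensor_lift_pure; do ?exact: gr_inner_fD.
  by rewrite lcs_brDl ptensorDr scalerDr.
Qed.

Fact gr_brE i j c d (a : lcs_quo G i) (b : lcs_quo G j) :
  gr_br (ptensor c a) (ptensor d b) = ptensor (c * d) (lcs_br a b).
Proof.
rewrite /gr_br tensor_lift_pure; last exact: gr_innerD.
rewrite tensor_lift_pure; last exact: gr_inner_fD.
by rewrite !ptensorZ mulr1.
Qed.

Fact gr_brDl i j (s s' : gr_piece i) (t : gr_piece j) :
  gr_br (s + s') t = gr_br s t + gr_br s' t.
Proof. by rewrite /gr_br tensor_liftD//; exact: gr_innerD. Qed.
Fact gr_brZl i j c (s : gr_piece i) (t : gr_piece j) :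
  gr_br (c *: s) t = c *: gr_br s t.
Proof. by rewrite /gr_br tensor_liftZ//; exact: gr_innerD. Qed.
Fact gr_br0l i j (t : gr_piece j) : gr_br (0 : gr_piece i) t = 0.
Proof. by rewrite -(scale0r 0) gr_brZl scale0r. Qed.

Fact gr_brDr i j (s : gr_piece i) (t t' : gr_piece j) :
  gr_br s (t + t') = gr_br s t + gr_br s t'.
Proof.
elim/tensor_ind: s => [|s s' IHs IHs'|d a].
- by rewrite !gr_br0l addr0.
- by rewrite !gr_brDl IHs IHs' addrACA.
rewrite /gr_br !tensor_lift_pure; do ?exact: gr_innerD.
by rewrite tensor_liftD ?scalerDr//; exact: gr_inner_fD.
Qed.
Fact gr_brZr i j c (s : gr_piece i) (t : gr_piece j) :
  gr_br s (c *: t) = c *: gr_br s t.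
Proof.
elim/tensor_ind: s => [|s s' IHs IHs'|d a].
- by rewrite !gr_br0l scaler0.
- by rewrite !gr_brDl IHs IHs' scalerDr.
rewrite /gr_br !tensor_lift_pure; do ?exact: gr_innerD.
rewrite tensor_liftZ; last exact: gr_inner_fD.
by rewrite !scalerA mulrC.
Qed.
Fact gr_br0r i j (s : gr_piece i) : gr_br s (0 : gr_piece j) = 0.
Proof. by rewrite -(scale0r 0) gr_brZr scale0r. Qed.

Fact gr_br_linearl i j c (s s' : gr_piece i) (t : gr_piece j) :
  gr_br (c *: s + s') t = c *: gr_br s t + gr_br s' t.
Proof. by rewrite gr_brDl gr_brZl. Qed.
Fact gr_br_linearr i j c (s : gr_piece i) (t t' : gr_piece j) :
  gr_br s (c *: t + t') = c *: gr_br s t + gr_br s t'.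
Proof. by rewrite gr_brDr gr_brZr. Qed.

Fact gr_cast0 i j (e : i = j) : ecast m (gr_piece m) e 0 = 0.
Proof. by case: j / e. Qed.
Fact gr_castD i j (e : i = j) (s t : gr_piece i) :
  ecast m (gr_piece m) e (s + t)
  = ecast m (gr_piece m) e s + ecast m (gr_piece m) e t.
Proof. by case: j / e. Qed.
Fact gr_cast_pure i j (e : i = j) c (a : lcs_quo G i) :
  ecast m (gr_piece m) e (ptensor c a)
  = ptensor c (ecast m (lcs_quo G m) e a).
Proof. by case: j / e. Qed.

Fact gr_brC i j (e : (i + j = j + i)%N) (s : gr_piece i) (t : gr_piece j) :
  gr_br t s = - ecast m (gr_piece m) e (gr_br s t).
Proof.
elim/tensor_ind: s => [|s s' IHs IHs'|c a].
- by rewrite gr_br0l gr_br0r gr_cast0 oppr0.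
- by rewrite gr_brDl gr_brDr gr_castD IHs IHs' opprD.
elim/tensor_ind: t => [|t t' IHt IHt'|d b].
- by rewrite gr_br0l gr_br0r gr_cast0 oppr0.
- by rewrite gr_brDl gr_brDr gr_castD IHt IHt' opprD.
by rewrite !gr_brE gr_cast_pure (lcs_brC e) mulrC ptensorNr.
Qed.

Fact gr_brxx i (s : gr_piece i) : gr_br s s = 0.
Proof.
elim/tensor_ind: s => [|s s' IHs IHs'|c a].
- exact: gr_br0l.
- rewrite gr_brDl !gr_brDr IHs IHs' add0r addr0.
  by rewrite (gr_brC (erefl _) s s') subrr.
by rewrite gr_brE lcs_brxx ptensor0r.
Qed.

Fact addr3ACA (V : zmodType) (a a' b b' c c' : V) :
  a + a' + (b + b') + (c + c') = a + b + c + (a' + b' + c').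
Proof. by rewrite (addrACA a) (addrACA (a + b)). Qed.

Fact gr_jacobi i j k (e1 : (j + k + i = i + j + k)%N)
    (e2 : (k + i + j = i + j + k)%N)
    (x : gr_piece i) (y : gr_piece j) (z : gr_piece k) :
  gr_br (gr_br x y) z + ecast m (gr_piece m) e1 (gr_br (gr_br y z) x)
    + ecast m (gr_piece m) e2 (gr_br (gr_br z x) y) = 0.
Proof.
elim/tensor_ind: x => [|x x' IHx IHx'|c a].
- by rewrite !(gr_br0l, gr_br0r, gr_cast0) !addr0.
- rewrite !(gr_brDl, gr_brDr, gr_castD) addr3ACA.
  by rewrite IHx IHx' addr0.
elim/tensor_ind: y => [|y y' IHy IHy'|d b].
- by rewrite !(gr_br0l, gr_br0r, gr_cast0) !addr0.
- rewrite !(gr_brDl, gr_brDr, gr_castD) addr3ACA.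
  by rewrite IHy IHy' addr0.
elim/tensor_ind: z => [|z z' IHz IHz'|f g].
- by rewrite !(gr_br0l, gr_br0r, gr_cast0) !addr0.
- rewrite !(gr_brDl, gr_brDr, gr_castD) addr3ACA.
  by rewrite IHz IHz' addr0.
rewrite !gr_brE !gr_cast_pure (mulrC (d * f)) (mulrC (f * c)) mulrA.
rewrite [d * (f * c)]mulrA [d * f * c]mulrC mulrA.
by rewrite -!ptensorDr lcs_jacobi ptensor0r.
Qed.

Definition gr : graded_lie K :=
  GradedLie gr_br_linearl gr_br_linearr gr_brxx gr_brC gr_jacobi.

Lemma gr_piece0 (t : gr_piece 0) : t = 0.
Proof.
elim/tensor_ind: t => [//|s t -> ->|c a]; first by rewrite addr0.
suff -> : a = 0 by rewrite ptensor0r.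
by elim/quotW: a => u; apply/lcs_quoP.
Qed.

End AssociatedGraded.

Arguments gr : clear implicits.

(* Main.v *)
From HB Require Import structures.
From mathcomp Require Import all_boot all_order all_algebra all_fingroup.
From mathcomp Require Import zify ring generic_quotient boolp.
Require Import Defs.

(** Only degrees 1 and 2 are used. Call two linear forms [a], [b] on the
    degree 1 piece of a graded Lie algebra resonant when the alternating form
    [a x * b y - b x * a y] factors through the bracket into degree 2. For
    the associated graded algebra, in characteristic 0, of a group [G] this
    says that [a] and [b], seen as characters [G -> K], have cup product
    zero. Resonance is carried along by isomorphisms, so it suffices to
    compare the planes of pairwise resonant forms for the three groups. It is
    bounded from above by commuting elements ([x * y = y * x] forces
    [a x * b y = b x * a y], lemma [resonant_commute]) and from below by
    functions [w : G -> K] whose defect [w (x * y) - w x - w y] is bilinear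
    (lemma [resonantI]), that is, by maps of [G] to Heisenberg-like groups.

    - Products of free groups: generators of different factors commute,
      whence a resonant plane lives on a single factor ([resonant_Pi_supp]);
      conversely all forms living on one factor are resonant
      ([Pi_supp_resonant]).

    - Upper McCool groups: evaluating the relations between the generators
      [alpha_ij] shows that every resonant plane contains a coordinate form
      [delta_ij], and that for some [k < j < i] it does not vanish
      identically at [alpha_ik], nor at [alpha_jk] ([wP_resonant_plane]).

    - Pure braid groups: braids map to a group of triples (permutation,
      numbers of crossings, correction indexed by triples of strands). On
      pure braids this gives twice the linking numbers, [l_pq], and, for each
      triple of strands, a function whose defect is a bilinear form in them.
      For the strands 1, 2, 3, 4 one gets five resonant planes: the
      combinations with zero coefficient sum of [l_pq, l_qr, l_rp] for each
      of the four triples, and those of [l12 + l34, l13 + l24, l14 + l23].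
      They all lie in the 5-dimensional space of combinations with zero sum
      of the six [l_pq], and any two of them meet in 0.

    The pure braid and McCool algebras differ: an isomorphism would yield
    five distinct coordinate forms, one in each of the five planes, hence a
    basis of the 5-dimensional space. Then no form of that space can be
    nonzero outside the corresponding five places [(i, j)]; but the plane
    whose [j] is least is nonzero at some [(i, k)] with [k < j].

    The pure braid and product algebras differ: the vector [l12 - l13] of the
    plane of 123, the vector [l34 - l24] of the plane of 234 and their sum,
    in the fifth plane, would each live on one factor, so all three on the
    same factor, and the first two would be resonant. This is excluded by the
    commuting braids [sigma_1 ^ 2] and [sigma_3 ^ 2].

    The product and McCool algebras differ: the last free factor has rank at
    least 3, which gives three independent, pairwise resonant forms whose
    span is made of pairwise resonant forms. That span would contain two
    distinct coordinate forms, and these would be resonant, although the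
    plane of two coordinate forms cannot be nonzero at the three places
    [(i, j)], [(i, k)], [(j, k)]. *)

Set Implicit Arguments.
Unset Strict Implicit.
Unset Printing Implicit Defensive.

Import GRing.Theory.
Local Open Scope ring_scope.

(** * Resonance in graded Lie algebras and in associated graded algebras *)

Section Resonance.
Variable K : fieldType.
Implicit Types L M : graded_lie K.

(** The dual form of the resonance variety: in characteristic 0 and for
    [L = gr G K] the functional [c] exists exactly when the cup product of
    the classes [a] and [b] vanishes. *)
Definition resonant L (a b : L 1%N -> K) : Prop :=
  exists2 c : L 2%N -> K, scalar c
    & forall x y, c (@gl_br K L 1 1 x y) = a x * b y - b x * a y.

Definition indep (T : Type) (a b : T -> K) : Prop :=
  forall c d, (forall x, c * a x + d * b x = 0) -> c = 0 /\ d = 0.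

Definition br_morph L M (f : forall k, {linear L k -> M k}) : Prop :=
  forall i j (x : L i) (y : L j),
    f (i + j)%N (gl_br x y) = gl_br (f i x) (f j y).

Lemma resonant_pull L M (f : forall k, {linear M k -> L k}) (a b : L 1%N -> K) :
  br_morph f -> resonant a b -> resonant (a \o f 1%N) (b \o f 1%N).
Proof.
move=> fbr [c c_lin c_br]; exists (c \o f 2%N) => [k x y|x y] /=.
  by rewrite linearP c_lin.
by have /= -> := fbr 1%N 1%N x y; rewrite c_br.
Qed.

(** A bijective linear map has a linear inverse, so that resonance can be
    transported in both directions. *)
Lemma graded_lie_isoP L M : graded_lie_iso L M ->
  exists (f : forall k, {linear L k -> M k})
         (g : forall k, {linear M k -> L k}),
    [/\ br_morph f, br_morph g, forall k, cancel (f k) (g k)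
      & forall k, cancel (g k) (f k)].
Proof.
move=> [f [f_bij f_br]].
have fgP k : {g : M k -> L k | cancel (f k) g /\ cancel g (f k)}.
  by apply: cid; have [g fK gK] := f_bij k; exists g.
pose g k := sval (fgP k).
have fK k : cancel (f k) (g k) by case: (svalP (fgP k)).
have gK k : cancel (g k) (f k) by case: (svalP (fgP k)).
have g_lin k : linear (g k).
  by move=> c x y; apply: (can_inj (fK k)); rewrite linearP !gK.
pose G k : {linear M k -> L k} :=
  HB.pack (g k) (GRing.isLinear.Build _ _ _ _ (g k) (g_lin k)).
exists f, G; split=> // i j x y.
by apply: (can_inj (fK _)); rewrite f_br !gK.
Qed.

End Resonance.

Section AssociatedGradedFunctionals.
Variables (G : groupType) (K : fieldType).
Local Notation L := (gr G K).

(** The class in degree 1 of a group element; these classes span degree 1. *)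
Definition gcls (x : G) : L 1%N :=
  ptensor (1 : K) (\pi_(lcs_quo G 1) (Subg (isT : x \in lcs G 1)))%qT.

Definition addchar (chi : G -> K) : Prop :=
  forall x y, chi (x * y)%g = chi x + chi y.

Lemma gclsM x y : gcls (x * y)%g = gcls x + gcls y.
Proof.
rewrite -ptensorDr -pi_lcs_quoM; congr (ptensor 1 (\pi_(lcs_quo G 1) _)%qT).
exact: val_inj.
Qed.

Lemma gl_br_gcls x y (h : [~ x, y]%g \in lcs G 2) :
  @gl_br K L 1 1 (gcls x) (gcls y) =
    ptensor (1 : K) (\pi_(lcs_quo G 2) (Subg h))%qT.
Proof.
rewrite [LHS]gr_brE mulr1 lcs_brE.
by congr (ptensor 1 (\pi_(lcs_quo G 2) _)%qT); exact: val_inj.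
Qed.

Lemma gl_br_commute x y :
  (x * y = y * x)%g -> @gl_br K L 1 1 (gcls x) (gcls y) = 0.
Proof.
move=> xy; have xy1 : [~ x, y]%g = 1%g by apply/eqP/commgP.
have h : [~ x, y]%g \in lcs G 2 by exact: (lcsR (i := 1) (j := 1)).
rewrite (gl_br_gcls h).
have -> : Subg h = 1%g :> subgroup_type (lcs G 2) by apply: val_inj.
by rewrite pi_lcs_quo1 ptensor0r.
Qed.

Lemma gr1_ind (P : L 1%N -> Prop) : P 0 ->
  (forall s t, P s -> P t -> P (s + t)) ->
  (forall c x, P (c *: gcls x)) -> forall t, P t.
Proof.
move=> P0 PD Pc; apply: tensor_ind => // c a.
elim/quotW: a => -[x xP].
have := Pc c x; rewrite /gcls [_ *: _]ptensorZ mulr1.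
by congr (P (ptensor c (\pi_(lcs_quo G 1) _)%qT)); exact: val_inj.
Qed.

Lemma scalar0 (V : lmodType K) (a : V -> K) : scalar a -> a 0 = 0.
Proof.
by move=> a_lin; have := a_lin (-1) 0 0; rewrite scaler0 addr0 mulN1r addNr.
Qed.

Lemma scalarZ (V : lmodType K) (a : V -> K) c x :
  scalar a -> a (c *: x) = c * a x.
Proof.
by move=> a_lin; have := a_lin c x 0; rewrite !addr0 scalar0 // addr0.
Qed.

Lemma scalarD (V : lmodType K) (a : V -> K) x y :
  scalar a -> a (x + y) = a x + a y.
Proof. by move=> a_lin; have := a_lin 1 x y; rewrite scale1r mul1r. Qed.

Lemma gcls_eq0 (a : L 1%N -> K) :
  scalar a -> (forall x, a (gcls x) = 0) -> forall t, a t = 0.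
Proof.
move=> a_lin a0; apply: gr1_ind => [|s t sP tP|c x].
- exact: scalar0.
- by rewrite scalarD // sP tP addr0.
- by rewrite scalarZ // a0 mulr0.
Qed.

(** Commuting elements have zero bracket: this is how relations of the group
    bound resonance from above. *)
Lemma resonant_commute (a b : L 1%N -> K) x y : (x * y = y * x)%g ->
  resonant a b -> a (gcls x) * b (gcls y) = b (gcls x) * a (gcls y).
Proof.
move=> xy [c c_lin c_br]; apply/eqP; rewrite -subr_eq0 -c_br gl_br_commute //.
by rewrite scalar0.
Qed.

Lemma addchar1 chi : addchar chi -> chi 1%g = 0.
Proof.
by move=> chiM; apply: (addrI (chi 1%g)); rewrite -chiM mulg1 addr0.
Qed.

Lemma addcharV chi x : addchar chi -> chi x^-1%g = - chi x.
Proof.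
by move=> chiM; apply/eqP; rewrite -addr_eq0 -chiM mulVg addchar1.
Qed.

Lemma addcharR chi x y : addchar chi -> chi [~ x, y]%g = 0.
Proof.
move=> chiM; rewrite /commg /conjg !chiM !addcharV //.
by ring.
Qed.

Lemma addchar_lcs2 chi x : addchar chi -> x \in lcs G 2 -> chi x = 0.
Proof.
move=> chiM; move: x; apply: gen_ind => [_ [x y _]||x y x0 y0|x x0].
- exact: addcharR.
- exact: addchar1.
- by rewrite chiM x0 y0 addr0.
- by rewrite addcharV // x0 oppr0.
Qed.

Section LiftQuotient.
Variables (k : nat) (w : G -> K).
Hypothesis wM : {in lcs G k &, forall x y, w (x * y)%g = w x + w y}.
Hypothesis w0 : forall x, x \in lcs G k.+1 -> w x = 0.

Let lift (a : lcs_quo G k) : K^o := w (val (repr a)).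

Let liftE (u : subgroup_type (lcs G k)) :
  lift (\pi_(lcs_quo G k) u)%qT = w (val u).
Proof.
have := lcs_quo_repr u; rewrite lcs_quo_eq_sym /lcs_quo_eq /lcs_eq /lift.
move: (repr _) => v uv.
rewrite -[val v](mulVKg (val u)) wM ?(valP u) ?(lcsS uv) //.
by rewrite (w0 uv) addr0.
Qed.

Let liftD : {morph lift : a b / a + b}.
Proof.
elim/quotW=> u; elim/quotW=> v; rewrite -pi_lcs_quoM !liftE.
by apply: wM; exact: valP.
Qed.

(** A function on the group that is additive on [lcs k] and kills
    [lcs k.+1], as a linear form on the piece of degree [k]. *)
Definition gr_functional : L k -> K := @tensor_lift K _ K^o lift.

Lemma gr_functional_scalar : scalar gr_functional.
Proof.
move=> c s t; rewrite /gr_functional tensor_liftD ?tensor_liftZ //.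
Qed.

Lemma gr_functionalE (u : subgroup_type (lcs G k)) :
  gr_functional (ptensor (1 : K) (\pi_(lcs_quo G k) u)%qT) = w (val u).
Proof. by rewrite /gr_functional tensor_lift_pure // liftE scale1r. Qed.

End LiftQuotient.

Definition char_functional (chi : G -> K) : L 1%N -> K :=
  @gr_functional 1 chi.

Lemma char_functional_scalar chi : addchar chi -> scalar (char_functional chi).
Proof.
move=> chiM; apply: gr_functional_scalar => [x y _ _|x]; first exact: chiM.
exact: addchar_lcs2.
Qed.

Lemma char_functionalE chi x :
  addchar chi -> char_functional chi (gcls x) = chi x.
Proof.
move=> chiM; apply: (gr_functionalE (k := 1)) => [y z _ _|y]; first exact: chiM.
exact: addchar_lcs2.
Qed.

(** The pair [(w, B)] encodes a homomorphism to a central extension: on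
    commutators [w] takes the values [B x y - B y x], and the bilinear [B]
    vanishes as soon as one argument is in [lcs 2]. So [w] is additive on
    [lcs 2], kills [lcs 3], and is the required linear form in degree 2. *)
Lemma resonantI (a b : L 1%N -> K) (w : G -> K) (B : G -> G -> K) :
    scalar a -> scalar b ->
    (forall x, addchar (B x)) -> (forall y, addchar (B^~ y)) ->
    (forall x y, w (x * y)%g = w x + w y + B x y) ->
    (forall x y, B x y - B y x
       = a (gcls x) * b (gcls y) - b (gcls x) * a (gcls y)) ->
  resonant a b.
Proof.
move=> a_lin b_lin Br Bl wM BE.
have B0 x y : y \in lcs G 2 -> B x y = 0 by exact: addchar_lcs2.
have w2M : {in lcs G 2 &, forall x y, w (x * y)%g = w x + w y}.
  by move=> x y _ y2; rewrite wM B0 // addr0.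
have wR x y : w [~ x, y]%g = B x y - B y x.
  have := wM (y * x)%g [~ x, y]%g.
  rewrite B0; last by exact: (lcsR (i := 1) (j := 1)).
  rewrite -commgC !wM addr0 => e.
  by apply: (addrI (w y + w x + B y x)); rewrite -e; ring.
have w1 : w 1%g = 0.
  by apply: (addrI (w 1%g)); rewrite -w2M ?gpred1 // mulg1 addr0.
have w3 x : x \in lcs G 3 -> w x = 0.
  have sub y : y \in lcs G 3 -> y \in lcs G 2 by exact: lcsS.
  suff: x \in lcs G 3 -> x \in lcs G 3 /\ w x = 0 by move=> + h => /(_ h) [].
  move: x; apply: gen_ind => [_ [x y x2]||x y [x3 x0] [y3 y0]|x [x3 x0]].
  - split; first exact: lcsR1.
    by rewrite wR (B0 y) // subr0; exact: (addchar_lcs2 (chi := B^~ y)).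
  - by split; rewrite ?gpred1.
  - by split; rewrite ?gpredM // w2M ?sub // x0 y0 addr0.
  - split; rewrite ?gpredV //; apply: (addrI (w x)).
    by rewrite -w2M ?gpredV ?sub // mulgV w1 x0 addr0.
pose c := @gr_functional 2 w.
have c_lin : scalar c by exact: gr_functional_scalar.
exists c => //.
have cE x y : c (@gl_br K L 1 1 (gcls x) (gcls y)) = B x y - B y x.
  have h : [~ x, y]%g \in lcs G 2 by exact: (lcsR (i := 1) (j := 1)).
  by rewrite (gl_br_gcls h) -wR; exact: (gr_functionalE (k := 2) w2M w3).
apply: gr1_ind => [y|s t sP tP y|e x].
- by rewrite [gl_br _ _]gr_br0l !scalar0 // !mul0r subrr.
- rewrite [gl_br _ _]gr_brDl !scalarD // [X in X + _]sP [X in _ + X]tP.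
  by ring.
apply: gr1_ind => [|s t sP tP|d y].
- by rewrite [gl_br _ _]gr_br0r !scalar0 // !mulr0 subrr.
- rewrite [gl_br _ _]gr_brDr !scalarD // [X in X + _]sP [X in _ + X]tP.
  by ring.
rewrite [gl_br _ _]gr_brZl [gr_br _ _]gr_brZr !scalarZ // [c _]cE BE.
by ring.
Qed.

End AssociatedGradedFunctionals.

(** * Presented groups and a twisted central extension *)

Section Presented.
Variables (I : choiceType) (R : word I -> word I -> Prop).

Lemma presg_ind (P : presg R -> Prop) :
    (forall i, P (pgen R i)) -> P 1%g ->
    (forall x y, P x -> P y -> P (x * y)%g) ->
    (forall x, P x -> P x^-1%g) ->
  forall x, P x.
Proof.
move=> Pg P1 PM PV; elim/quotW; elim=> [//|[i b] w IHw].
have -> : (\pi_(presg R) ((i, b) :: w))%qT =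
    ((\pi_(presg R) [:: (i, b)])%qT * (\pi_(presg R) w)%qT)%g.
  by rewrite [RHS]pres_mulE.
by apply: PM => //; case: b; [rewrite -pgenV; apply: PV|]; exact: Pg.
Qed.

Lemma addchar_presg_eq (K : fieldType) (chi psi : presg R -> K) :
    addchar chi -> addchar psi ->
    (forall i, chi (pgen R i) = psi (pgen R i)) -> chi =1 psi.
Proof.
move=> chiM psiM gE; apply: presg_ind => // [|x y ex ey|x ex].
- by rewrite !addchar1.
- by rewrite chiM psiM ex ey.
- by rewrite !addcharV // ex.
Qed.

End Presented.

(** A group [S] acting on two abelian groups [V] and [W], and an equivariant
    biadditive map [beta] from pairs of elements of [V] to [W]; [beta]
    serves as the cocycle of a central extension of [V] by [W], on which [S]
    still acts. *)
Record ext_data := ExtData {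
  ext_S : groupType; ext_V : zmodType; ext_W : zmodType;
  ext_aV : ext_S -> ext_V -> ext_V;
  ext_aW : ext_S -> ext_W -> ext_W;
  ext_beta : ext_V -> ext_V -> ext_W;
  ext_aV1 : forall v, ext_aV 1%g v = v;
  ext_aW1 : forall w, ext_aW 1%g w = w;
  ext_aVM : forall s t v, ext_aV (s * t)%g v = ext_aV s (ext_aV t v);
  ext_aWM : forall s t w, ext_aW (s * t)%g w = ext_aW s (ext_aW t w);
  ext_aVD : forall s, {morph ext_aV s : u v / u + v};
  ext_aWD : forall s, {morph ext_aW s : u v / u + v};
  ext_betaDl : forall v, {morph ext_beta^~ v : u u' / u + u'};
  ext_betaDr : forall u, {morph ext_beta u : v v' / v + v'};
  ext_beta_equiv : forall s u v,
    ext_beta (ext_aV s u) (ext_aV s v) = ext_aW s (ext_beta u v) }.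

Section Extension.
Variable d : ext_data.

(** The semidirect product of [S] with that central extension. Heisenberg
    groups ([S] trivial) and the target of the braid group are instances. *)
Definition ext : Type := (ext_S d * ext_V d * ext_W d)%type.
Implicit Types x y z : ext.

HB.instance Definition _ := Choice.on ext.

Definition ext_one : ext := (1%g, 0, 0).
Definition ext_mul x y : ext :=
  ((x.1.1 * y.1.1)%g, x.1.2 + ext_aV x.1.1 y.1.2,
   x.2 + ext_aW x.1.1 y.2 + ext_beta x.1.2 (ext_aV x.1.1 y.1.2)).
Definition ext_inv x : ext :=
  let s := x.1.1^-1%g in
  (s, - ext_aV s x.1.2, ext_aW s (ext_beta x.1.2 x.1.2 - x.2)).

Let morph0 (V W : zmodType) (f : V -> W) : {morph f : x y / x + y} -> f 0 = 0.
Proof. by move=> fD; apply: (addrI (f 0)); rewrite -fD !addr0. Qed.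
Let morphN (V W : zmodType) (f : V -> W) (v : V) :
  {morph f : x y / x + y} -> f (- v) = - f v.
Proof.
by move=> fD; apply/eqP; rewrite -addr_eq0 -fD addNr; apply/eqP/morph0.
Qed.

Fact ext_mulA : associative ext_mul.
Proof.
move=> [[s v] w] [[s' v'] w'] [[s'' v''] w'']; rewrite /ext_mul /=.
rewrite mulgA !ext_aVD !ext_aVM !ext_aWD !ext_aWM !ext_betaDl !ext_betaDr.
rewrite ext_beta_equiv !addrA; congr (_, _, _).
do 2 rewrite [in LHS](addrAC _ _ (ext_beta v (ext_aV s v'))).
by rewrite [LHS]addrAC.
Qed.
Fact ext_mul1g : left_id ext_one ext_mul.
Proof.
move=> [[s v] w]; rewrite /ext_mul /= mul1g ext_aV1 ext_aW1 !add0r.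
by rewrite (morph0 (f := (@ext_beta d)^~ _)) ?addr0 // => ? ?; rewrite ext_betaDl.
Qed.
Fact ext_mulg1 : right_id ext_one ext_mul.
Proof.
move=> [[s v] w]; rewrite /ext_mul /= mulg1 !(morph0 (@ext_aVD d s)).
by rewrite (morph0 (@ext_aWD d s)) (morph0 (@ext_betaDr d v)) !addr0.
Qed.
Fact ext_mulgV : right_inverse ext_one ext_inv ext_mul.
Proof.
move=> [[s v] w]; rewrite /ext_mul /= mulgV (morphN _ (@ext_aVD d s)).
rewrite -ext_aVM -ext_aWM mulgV ext_aV1 ext_aW1 subrr.
rewrite (morphN _ (@ext_betaDr d v)) addrCA subrr addr0; congr (_, _, _).
by rewrite subrr.
Qed.
Fact ext_mulVg : left_inverse ext_one ext_inv ext_mul.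
Proof.
move=> [[s v] w]; rewrite /ext_mul /= mulVg addNr.
rewrite -ext_aWD subrK; congr (_, _, _).
set u := ext_aV _ v; rewrite (morphN (f := (@ext_beta d)^~ _)); last first.
  by move=> ? ?; rewrite ext_betaDl.
by rewrite ext_beta_equiv subrr.
Qed.

HB.instance Definition _ := isGroup.Build ext
  ext_mulA ext_mul1g ext_mulg1 ext_mulVg ext_mulgV.

End Extension.

Section ExtMul3.
Variable d : ext_data.
Implicit Types x y z : ext d.

(** The shape in which both sides of a braid relation are compared. *)
Lemma ext_mul3 x y z : let v1 := x.1.2 in
  let v2 := ext_aV x.1.1 y.1.2 in
  let v3 := ext_aV x.1.1 (ext_aV y.1.1 z.1.2) in
  (x * (y * z))%g = ((x.1.1 * (y.1.1 * z.1.1))%g, v1 + v2 + v3,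
    x.2 + ext_aW x.1.1 y.2 + ext_aW x.1.1 (ext_aW y.1.1 z.2)
    + (ext_beta v1 v2 + ext_beta v1 v3 + ext_beta v2 v3)).
Proof.
move=> v1 v2 v3; rewrite mulgA [LHS]/(mul _ _) /= /ext_mul /=.
rewrite mulgA -/v2 ext_aVM ext_aWM -/v3 ext_betaDl.
congr (_, _, _); rewrite -!addrA; congr (_ + (_ + _)).
by rewrite addrCA.
Qed.

End ExtMul3.

(** * Products of free groups *)

Section Heisenberg.
Variable K : fieldType.

(** The permutation group of the empty set is used as a trivial group. *)
Definition heis_data : ext_data.
Proof.
refine (@ExtData {perm 'I_0} (K * K)%type K (fun=> id) (fun=> id)
  (fun u v => u.1 * v.2) _ _ _ _ _ _ _ _ _) => //= [v u u'|u v v'].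
- exact: mulrDl.
- exact: mulrDr.
Defined.

Variables (m : nat) (f g : 'I_m -> K).

(** The Heisenberg group receives a homomorphism with prescribed values on
    free generators; its coordinates are two characters and a function whose
    defect is their product. *)
Lemma free_group_heis : exists chi psi w : free_group m -> K,
  [/\ addchar chi, addchar psi,
      forall x y, w (x * y)%g = w x + w y + chi x * psi y
    & forall k, chi (pgen _ k) = f k /\ psi (pgen _ k) = g k].
Proof.
pose h : 'I_m -> ext heis_data := fun k => (1%g, (f k, g k), 0).
pose rho : free_group m -> ext heis_data := pres_lift h.
have rhoM : {morph rho : x y / (x * y)%g} by exact: pres_liftM.
exists (fun x => (rho x).1.2.1), (fun x => (rho x).1.2.2), (fun x => (rho x).2).
split=> [x y|x y|x y|k]; rewrite ?rhoM //.
by rewrite /rho pres_lift_gen.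
Qed.

End Heisenberg.

Section FreeProduct.
Variables (K : fieldType) (n : nat).
Local Notation Pi := (Pi_group n).
Local Notation L := (gr Pi K).
Implicit Types (i j : 'I_n.-1) (a b : L 1%N -> K).

Definition Pi_inj i (x : free_group i.+1) : Pi :=
  dfwith (fun j => 1%g : free_group j.+1) x.

Lemma Pi_inj_in i (x : free_group i.+1) : Pi_inj x i = x.
Proof. by rewrite /Pi_inj dfwith_in. Qed.

Lemma Pi_inj_out i j (x : free_group i.+1) : i != j -> Pi_inj x j = 1%g.
Proof. by move=> ij; rewrite /Pi_inj dfwith_out. Qed.

Lemma Pi_injM i : {morph @Pi_inj i : x y / (x * y)%g}.
Proof.
move=> x y; apply: functional_extensionality_dep => j.
rewrite [RHS]/(dprodg_mul _ _ _).
by case: (eqVneq i j) => [<-|ij]; rewrite ?Pi_inj_in // !Pi_inj_out ?mulg1.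
Qed.

Lemma Pi_inj_commute i j (x : free_group i.+1) (y : free_group j.+1) :
  i != j -> (Pi_inj x * Pi_inj y = Pi_inj y * Pi_inj x)%g.
Proof.
move=> ij; apply: functional_extensionality_dep => k.
rewrite [LHS]/(dprodg_mul _ _ _) [RHS]/(dprodg_mul _ _ _).
case: (eqVneq i k) => [ik|ik].
  have jk : j != k by rewrite -ik eq_sym.
  by rewrite !(Pi_inj_out y jk) mulg1 mul1g.
by rewrite !(Pi_inj_out x ik) mulg1 mul1g.
Qed.

(** The factors generate: an element is built up from its components one
    index at a time. *)
Lemma addchar_Pi_eq0 (chi : Pi -> K) : addchar chi ->
  (forall i k, chi (Pi_inj (pgen _ k : free_group i.+1)) = 0) ->
  forall x, chi x = 0.
Proof.
move=> chiM chi0 x.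
have chi_inj i (y : free_group i.+1) : chi (Pi_inj y) = 0.
  have := @addchar_presg_eq _ _ K (chi \o @Pi_inj i) (fun=> 0).
  apply=> [u v|u v|k] /=; rewrite ?Pi_injM ?chiM ?addr0 //.
pose part (s : seq 'I_n.-1) : Pi := fun j => if j \in s then x j else 1%g.
have part0 s : uniq s -> chi (part s) = 0.
  elim: s => [_|i s IHs /= /andP[is_ s_uniq]]; first exact: (addchar1 chiM).
  have -> : part (i :: s) = (Pi_inj (x i) * part s)%g.
    apply: functional_extensionality_dep => j.
    rewrite [RHS]/(dprodg_mul _ _ _) /part in_cons.
    case: (eqVneq j i) => [->|ji] /=.
      by rewrite Pi_inj_in (negbTE is_) mulg1.
    by rewrite Pi_inj_out ?mul1g // eq_sym.
  by rewrite chiM chi_inj IHs // addr0.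
have -> : x = part (enum 'I_n.-1).
  by apply: functional_extensionality_dep => j; rewrite /part mem_enum.
exact/part0/enum_uniq.
Qed.

Lemma Pi_functional_eq a b : scalar a -> scalar b ->
  (forall i k, a (gcls K (Pi_inj (pgen _ k : free_group i.+1))) =
    b (gcls K (Pi_inj (pgen _ k : free_group i.+1)))) ->
  forall x, a (gcls K x) = b (gcls K x).
Proof.
move=> a_lin b_lin ab x; apply/eqP; rewrite -subr_eq0; apply/eqP; move: x.
apply: addchar_Pi_eq0 => [x y|i k]; last by rewrite ab subrr.
by rewrite gclsM !scalarD //; ring.
Qed.

Definition Pi_supp i a := forall j k, j != i ->
  a (gcls K (Pi_inj (pgen _ k : free_group j.+1))) = 0.

(** Forms living on one factor come from a free group, where every pair of
    characters lifts to a Heisenberg group. *)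
Lemma Pi_supp_resonant i a b : scalar a -> scalar b ->
  Pi_supp i a -> Pi_supp i b -> resonant a b.
Proof.
move=> a_lin b_lin ai bi.
pose val (c : L 1%N -> K) k := c (gcls K (Pi_inj (pgen _ k : free_group i.+1))).
have [chi [psi [w [chiM psiM wM gE]]]] := free_group_heis (val a) (val b).
have addP (xi : free_group i.+1 -> K) : addchar xi ->
    addchar (fun x : Pi => xi (x i)).
  by move=> xiM x y; rewrite -xiM.
have projE (c : L 1%N -> K) (xi : free_group i.+1 -> K) x : scalar c ->
    addchar xi -> Pi_supp i c -> (forall k, xi (pgen _ k) = val c k) ->
    c (gcls K x) = xi (x i).
  move=> c_lin xiM ci xiE; have xiP := addP _ xiM.
  rewrite -[RHS](char_functionalE x xiP); apply: Pi_functional_eq => // [|j k].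
    exact: char_functional_scalar.
  rewrite char_functionalE //.
  case: (eqVneq j i) k => [->|ji] k; first by rewrite Pi_inj_in xiE.
  by rewrite ci // Pi_inj_out // addchar1.
have aE x : a (gcls K x) = chi (x i) by apply: projE => // k; case: (gE k).
have bE x : b (gcls K x) = psi (x i) by apply: projE => // k; case: (gE k).
apply: (@resonantI _ _ a b (fun x : Pi => w (x i))
  (fun x y => chi (x i) * psi (y i))) => // [x y z|y x z|x y|x y].
- by rewrite [psi _]psiM mulrDr.
- by rewrite [chi _]chiM mulrDl.
- exact: wM.
- by rewrite !aE !bE; ring.
Qed.

(** Write [v x] for the pair [(a x, b x)] of values at a generator [x].
    Generators of different factors commute, so their pairs are parallel. If
    nonzero pairs occurred in two factors, then all pairs would be parallel
    to a single one, and [a], [b] would be dependent. *)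
Lemma resonant_Pi_supp a b : scalar a -> scalar b -> resonant a b ->
  indep a b -> exists i, Pi_supp i a /\ Pi_supp i b.
Proof.
move=> a_lin b_lin ab_res ab_ind.
pose A i (k : 'I_i.+1) := a (gcls K (Pi_inj (pgen _ k : free_group i.+1))).
pose B i (k : 'I_i.+1) := b (gcls K (Pi_inj (pgen _ k : free_group i.+1))).
have par i j (k : 'I_i.+1) (l : 'I_j.+1) :
    i != j -> A i k * B j l = B i k * A j l.
  by move=> ij; exact: (resonant_commute (Pi_inj_commute _ _ ij) ab_res).
(* a nontrivial relation on all generators contradicts independence *)
have dep (c d : K) : (c != 0) || (d != 0) ->
    (forall i (k : 'I_i.+1), c * A i k + d * B i k = 0) -> False.
  move=> cd0 cdE; suff [c0 d0] : c = 0 /\ d = 0.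
    by rewrite c0 d0 eqxx in cd0.
  apply: ab_ind => x.
  apply: (@gcls_eq0 _ _ (fun x => c * a x + d * b x)) => [e u v|{}x].
    by rewrite a_lin b_lin; ring.
  rewrite -[RHS]/((fun=> 0 : K) x); move: x; apply: addchar_Pi_eq0 => [x y|i k].
    by rewrite gclsM !scalarD //; ring.
  exact: cdE.
have [[i [k Aik]]|no] := pselect (exists i, exists k : 'I_i.+1,
    (A i k != 0) || (B i k != 0)); last first.
  case: (dep 1 0) => [|i k]; first by rewrite oner_eq0.
  rewrite mul1r mul0r addr0; apply: contrapT => /eqP A0.
  by apply: no; exists i, k; rewrite A0.
have [[j [l [ji Bjl]]]|no] := pselect (exists j, exists l : 'I_j.+1,
    j != i /\ ((A j l != 0) || (B j l != 0))).
  case: (dep (B i k) (- A i k)) => [|h m]; first by rewrite oppr_eq0 orbC.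
  apply/eqP; rewrite mulNr subr_eq0; apply/eqP.
  case: (eqVneq h i) m => [->|hi] m; last by rewrite par // eq_sym.
  have := par j i l k ji; have := par j i l m ji.
  case/orP: Bjl => nz e1 e2; apply: (mulfI nz).
    by rewrite mulrA e2 (mulrCA (A j l)) e1; ring.
  by rewrite (mulrCA (B j l) (B i k)) -e1 [RHS]mulrA -e2; ring.
exists i; split=> j l ji; apply/eqP/negP => /negP nz; apply: no; exists j, l.
  by split=> //; rewrite /A nz.
by split=> //; rewrite /B nz orbT.
Qed.

Lemma Pi_coordinate i (f : 'I_i.+1 -> K) : exists a : L 1%N -> K,
  [/\ scalar a, Pi_supp i a &
    forall k, a (gcls K (Pi_inj (pgen _ k : free_group i.+1))) = f k].
Proof.
have [chi [psi [w [chiM _ _ chiE]]]] := free_group_heis f f.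
have addP : addchar (fun x : Pi => chi (x i)) by move=> x y; rewrite -chiM.
exists (char_functional (fun x : Pi => chi (x i))).
split=> [|j k ji|k]; first exact: char_functional_scalar.
  by rewrite char_functionalE // Pi_inj_out // addchar1.
by rewrite char_functionalE // Pi_inj_in; case: (chiE k).
Qed.

End FreeProduct.

(** * Upper McCool groups *)

Section McCoolRelations.
Local Open Scope group_scope.
Variable n : nat.
Implicit Types i j k l : 'I_n.

Lemma autg_ext (f g : autg (free_group n)) :
  (forall m, f (pgen _ m) = g (pgen _ m)) -> f = g.
Proof. by move=> fg; apply: autgP; apply: pres_ext fg; exact: autgM. Qed.

Let mccool_funV' i j x : mccool_fun i j x^-1 = (mccool_fun i j x)^-1.
Proof. exact: (morphgV (@mccool_funM n i j)). Qed.

Let mcE := (@mccool_funM n, mccool_funV', @mccool_fun_gen n, eqxx).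

Lemma mccool_disjoint i j k l (ji : j != i) (lk : l != k) :
  i != k -> i != l -> j != k -> mccool ji * mccool lk = mccool lk * mccool ji.
Proof.
move=> /negbTE ik /negbTE il /negbTE jk; apply: autg_ext => m.
have ki : (k == i) = false by rewrite eq_sym.
have li : (l == i) = false by rewrite eq_sym.
have [->|mi] := eqVneq m i; first by do 5 ?rewrite ?(mcE, ik, jk) /=.
have [->|mk] := eqVneq m k; first by do 5 ?rewrite ?(mcE, ki, li) /=.
by move: mi mk => /negbTE mi /negbTE mk; do 5 ?rewrite ?(mcE, mi, mk) /=.
Qed.

(** [alpha_ik * alpha_jk] conjugates both [x_i] and [x_j] by [x_k], so it
    acts on the subgroup generated by [x_i] and [x_j] as an inner
    automorphism by an element that [alpha_ij] fixes. *)
Lemma mccool_star i j k (ji : j != i) (ki : k != i) (kj : k != j) :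
  mccool ji * (mccool ki * mccool kj) = mccool ki * mccool kj * mccool ji.
Proof.
have ij : (i == j) = false by rewrite eq_sym (negbTE ji).
have [ji' [ki' kj']] : (j == i) = false /\ (k == i) = false /\ (k == j) = false.
  by split; [|split]; exact: negbTE.
apply: autg_ext => m.
have [->|mj] := eqVneq m j.
  by do 5 ?rewrite ?(mcE, ij, ji', ki', kj') /=.
have [->|mi] := eqVneq m i; last first.
  by move: mi mj => /negbTE mi /negbTE mj; do 5 ?rewrite ?(mcE, mi, mj) /=.
do 5 ?rewrite ?(mcE, ij, ji', ki', kj') /=.
by rewrite !invgM !invgK !mulgA !mulgVK.
Qed.

Lemma mccool_same i j k (ki : k != i) (kj : k != j) :
  i != j -> mccool ki * mccool kj = mccool kj * mccool ki.
Proof. by move=> ij; apply: mccool_disjoint => //; rewrite eq_sym. Qed.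

End McCoolRelations.

Section McCoolCoordinates.
Variables (K : fieldType) (n : nat).
Local Notation wP := (upper_mccool_group n).
Local Notation L := (gr wP K).
Implicit Types (i j k : 'I_n).

Lemma gt_ord_neq i j : (j < i)%N -> j != i.
Proof. by move=> ji; rewrite -(inj_eq val_inj) /= ltn_eqF. Qed.

Lemma mccool_in i j (ji : (j < i)%N) :
  mccool (gt_ord_neq ji) \in gen (@upper_mccool_gen n).
Proof. by apply/genP/gen_in/UpperMcCoolGen. Qed.

Definition alpha i j (ji : (j < i)%N) : wP := Subg (mccool_in ji).

Lemma addchar_wP_eq0 (chi : wP -> K) : addchar chi ->
  (forall i j (ji : (j < i)%N), chi (alpha ji) = 0) -> forall x, chi x = 0.
Proof.
move=> chiM chi0 [x xP]; have /genP xg := xP.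
elim: xg xP => {x} [x gx||x y xg IHx yg IHy|x xg IHx] xP.
- case: x / gx xP => i j ji lt xP.
  rewrite -[RHS](chi0 _ _ lt); congr chi; apply: val_inj => /=.
  by congr mccool; exact: eq_irrelevance.
- by rewrite -[RHS](addchar1 chiM); congr chi; exact: val_inj.
- have xP' : x \in gen (@upper_mccool_gen n) by apply/genP.
  have yP' : y \in gen (@upper_mccool_gen n) by apply/genP.
  rewrite (_ : Subg xP = (Subg xP' * Subg yP')%g); last exact: val_inj.
  by rewrite chiM IHx IHy addr0.
- have xP' : x \in gen (@upper_mccool_gen n) by apply/genP.
  rewrite (_ : Subg xP = (Subg xP')^-1%g); last exact: val_inj.
  by rewrite addcharV // IHx oppr0.
Qed.

(** The value of a form at [alpha_ij], extended by 0 to the pairs that do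
    not satisfy [j < i], so that it becomes a total function of two indices. *)
Definition wP_coord (a : L 1%N -> K) i j : K :=
  if (j < i)%N =P true is ReflectT ji then a (gcls K (alpha ji)) else 0.

Lemma wP_coordE a i j (ji : (j < i)%N) :
  wP_coord a i j = a (gcls K (alpha ji)).
Proof.
rewrite /wP_coord; case: eqP => [ji'|]; last by rewrite ji.
by congr (a (gcls K (alpha _))); exact: eq_irrelevance.
Qed.

Lemma wP_coord0 a i j : ~~ (j < i)%N -> wP_coord a i j = 0.
Proof.
by move=> nji; rewrite /wP_coord; case: eqP => // ji; rewrite ji in nji.
Qed.

Lemma wP_coord_eq0 a : scalar a -> (forall i j, wP_coord a i j = 0) ->
  forall x, a x = 0.
Proof.
move=> a_lin a0; apply: gcls_eq0 => //; apply: addchar_wP_eq0 => [x y|i j ji].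
  by rewrite gclsM scalarD.
by rewrite -wP_coordE.
Qed.

Section Resonant.
Variables a b : L 1%N -> K.
Hypotheses (a_lin : scalar a) (b_lin : scalar b).
Hypotheses (ab_res : resonant a b).
Let A := wP_coord a.
Let B := wP_coord b.
(** The 2 x 2 minors of the plane of [a] and [b] in the coordinates
    [alpha_ij]. The relations of the group say which of them vanish or
    agree. *)
Definition wP_minor i j k l := wP_coord a i j * wP_coord b k l -
  wP_coord b i j * wP_coord a k l.
Local Notation mn := wP_minor.

Lemma wP_minor_disjoint i j k l : uniq [:: i; j; k; l] -> mn i j k l = 0.
Proof.
rewrite /= !inE !negb_or => /and4P[/and3P[ij ik il] /andP[jk jl] kl _].
have [ji|ji] := boolP (j < i)%N; last by rewrite /mn !(wP_coord0 _ ji); ring.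
have [lk|lk] := boolP (l < k)%N; last by rewrite /mn !(wP_coord0 _ lk); ring.
rewrite /mn !(wP_coordE _ ji) !(wP_coordE _ lk).
apply/eqP; rewrite subr_eq0; apply/eqP; apply: resonant_commute ab_res.
by apply: val_inj; apply: mccool_disjoint.
Qed.

Lemma wP_minor_same i j k : mn i k j k = 0.
Proof.
have [ki|ki] := boolP (k < i)%N; last by rewrite /mn !(wP_coord0 _ ki); ring.
have [kj|kj] := boolP (k < j)%N; last by rewrite /mn !(wP_coord0 _ kj); ring.
have [->|ij] := eqVneq i j; first by rewrite /mn; ring.
rewrite /mn !(wP_coordE _ ki) !(wP_coordE _ kj).
apply/eqP; rewrite subr_eq0; apply/eqP; apply: resonant_commute ab_res.
by apply: val_inj; apply: mccool_same.
Qed.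

Lemma wP_minor_star i j k : (k < j)%N -> (j < i)%N ->
  mn i j i k + mn i j j k = 0.
Proof.
move=> kj ji; have ki := ltn_trans kj ji.
rewrite /mn !(wP_coordE _ ki) !(wP_coordE _ kj) !(wP_coordE _ ji).
have rel : (alpha ji * (alpha ki * alpha kj) = alpha ki * alpha kj * alpha ji)%g.
  by apply: val_inj; apply: mccool_star.
have /eqP := resonant_commute rel ab_res.
rewrite !gclsM !scalarD // -subr_eq0 => /eqP e.
by rewrite -[RHS]e; ring.
Qed.

Let mnC i j k l : mn i j k l = - mn k l i j.
Proof. by rewrite /mn; ring. Qed.

Lemma wP_minor_neq0 : indep a b -> exists p q r s, mn p q r s != 0.
Proof.
move=> ab_ind; apply: contrapT => no.
have mn0 p q r s : mn p q r s = 0.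
  by apply: contrapT => /eqP nz; apply: no; exists p, q, r, s.
have dep c d : (forall p q, c * A p q + d * B p q = 0) -> c = 0 /\ d = 0.
  move=> cd; apply: ab_ind.
  apply: (@wP_coord_eq0 (fun x => c * a x + d * b x)) => [e u v|p q].
    by rewrite a_lin b_lin; ring.
  rewrite -[RHS](cd p q) /A /B; have [qp|qp] := boolP (q < p)%N.
    by rewrite !(wP_coordE _ qp).
  by rewrite !(wP_coord0 _ qp) !mulr0 addr0.
have A0 p q : A p q = 0.
  suff [] : - B p q = 0 /\ A p q = 0 by [].
  by apply: dep => r s; rewrite -[RHS](mn0 p q r s) /mn /A /B; ring.
suff [/eqP] : 1 = 0 :> K /\ 0 = 0 :> K by rewrite oner_eq0.
by apply: dep => p q; rewrite A0; ring.
Qed.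

(** The relations kill the minors of disjoint pairs and of pairs with the
    same lower index. What remains is [(ij, ik)] and [(ij, jk)] with
    [k < j < i], and these two are opposite. *)
Lemma wP_minor_top : indep a b ->
  exists i j k, [/\ (k < j)%N, (j < i)%N & mn i j i k != 0].
Proof.
move=> /wP_minor_neq0 [p [q [r [s nz]]]].
have qp : (q < p)%N.
  by apply: contraNT nz => qp; apply/eqP; rewrite /mn !(wP_coord0 _ qp); ring.
have sr : (s < r)%N.
  by apply: contraNT nz => sr; apply/eqP; rewrite /mn !(wP_coord0 _ sr); ring.
have top i j k : (k < j)%N -> (j < i)%N -> mn i j j k != 0 -> mn i j i k != 0.
  move=> kj ji; apply: contraNN => /eqP e.
  by apply/eqP; rewrite -[LHS]add0r -[X in X + _]e wP_minor_star.
have [pr|pr] := eqVneq p r.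
  subst r; case: (ltngtP q s) => [qs|sq|/val_inj qs].
  - by exists p, s, q; split=> //; rewrite mnC oppr_eq0.
  - by exists p, q, s.
  - by case/eqP: nz; rewrite qs /mn; ring.
have [qs|qs] := eqVneq q s; first by rewrite qs wP_minor_same eqxx in nz.
have [ps|ps] := eqVneq p s.
  by subst s; exists r, p, q; split=> //; apply: top; rewrite // mnC oppr_eq0.
have [qr|qr] := eqVneq q r.
  by subst r; exists p, q, s; split=> //; apply: top.
rewrite wP_minor_disjoint ?eqxx // in nz.
rewrite /= !inE !negb_or pr ps qr qs (eq_sym r) (eq_sym p) !gt_ord_neq //.
Qed.

(** Take [k < j < i] with [mu], the minor of [ij] and [ik], nonzero, so that
    the form with value [minor (pq, ik) / mu] at [pq] lies in the plane. It
    is [delta_ij]: the Pluecker relation for [ij, ik, jk, pq] identifies the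
    minors [(pq, ik)] and [(jk, pq)], so a nonzero one forces [pq] to meet
    both [ik] and [jk]; this leaves, apart from [ij], only pairs containing
    [k], and those are excluded by the relations. *)
Lemma wP_resonant_plane : indep a b -> exists i j k,
  [/\ (k < j)%N, (j < i)%N,
      exists c d, forall p q,
        c * A p q + d * B p q = ((p == i) && (q == j))%:R,
      (A i k != 0) || (B i k != 0) & (A j k != 0) || (B j k != 0)].
Proof.
move=> /wP_minor_top [i [j [k [kj ji nz]]]]; have ki := ltn_trans kj ji.
set mu := mn i j i k in nz.
have jk_mu : mn i j j k = - mu.
  by apply/eqP; rewrite -addr_eq0 addrC wP_minor_star.
(* the Pluecker relation for ij, ik, jk, pq, in which two minors are known *)
have pluecker p q : mn j k p q = - mn i k p q.
  apply/eqP; rewrite -addr_eq0; apply/eqP/(mulfI nz).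
  transitivity (- (mn i j p q * mn i k j k) +
      (mn i j j k + mu) * mn i k p q); first by rewrite /mu /mn; ring.
  by rewrite wP_minor_same jk_mu addNr; ring.
have ik0 p q : (p, q) != (i, j) -> mn i k p q = 0.
  move=> pq_ij; have [qp|qp] := boolP (q < p)%N; last first.
    by rewrite /mn !(wP_coord0 _ qp); ring.
  have dj p' q' : uniq [:: j; k; p'; q'] -> mn i k p' q' = 0.
    by move=> u; apply/eqP; rewrite -oppr_eq0 -pluecker wP_minor_disjoint.
  have [qk|qk] := eqVneq q k; first by rewrite qk wP_minor_same.
  have [pk|pk] := eqVneq p k.
    subst p; have := wP_minor_star qp ki; rewrite dj ?add0r //.
    by rewrite /= !inE -!(inj_eq val_inj) /=; lia.
  have [/andP[pi qi]|] := boolP ((p != i) && (q != i)).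
    apply: wP_minor_disjoint; move: pk qk pi qi.
    by rewrite /= !inE -!(inj_eq val_inj) /=; lia.
  have [/andP[pj qj] _|] := boolP ((p != j) && (q != j)).
    apply: dj; move: pk qk pj qj.
    by rewrite /= !inE -!(inj_eq val_inj) /=; lia.
  by move: pq_ij; rewrite xpair_eqE -!(inj_eq val_inj) /=; lia.
exists i, j, k; split=> //.
- exists (B i k / mu), (- (A i k / mu)) => p q.
  have -> : B i k / mu * A p q + - (A i k / mu) * B p q = - mn i k p q / mu.
    by rewrite /mn /A /B; field.
  have [/eqP[-> ->]|pq] := boolP ((p, q) == (i, j)).
    by rewrite !eqxx -mnC divff.
  by move: (pq); rewrite xpair_eqE ik0 // oppr0 mul0r => /negbTE->.
- apply: contraNT nz; rewrite negb_or !negbK => /andP[/eqP A0 /eqP B0].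
  by rewrite /mu /mn -/A -/B A0 B0 !mulr0 subrr.
- apply: contraNT nz; rewrite negb_or !negbK => /andP[/eqP A0 /eqP B0].
  by rewrite -oppr_eq0 -jk_mu /mn -/A -/B A0 B0 !mulr0 subrr.
Qed.
End Resonant.
End McCoolCoordinates.

(** * A degree-two invariant of braids *)

Definition swapn k p := if p == k then k.+1 else if p == k.+1 then k else p.

Ltac swapn_cases k p :=
  rewrite /swapn; case: (p =P k) => ?; [|case: (p =P k.+1) => ?]; lia.

Lemma swapn_ltn k p : (swapn k p < k)%N = (p < k)%N.
Proof. by swapn_cases k p. Qed.
Lemma swapn_eq k p : (swapn k p == k) = (p == k.+1).
Proof. by swapn_cases k p. Qed.
Lemma swapn_eqS k p : (swapn k p == k.+1) = (p == k).
Proof. by swapn_cases k p. Qed.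
Lemma swapn_eq2 k p : (swapn k p == k.+2) = (p == k.+2).
Proof. by swapn_cases k p. Qed.
Lemma swapnS_eq k p : (swapn k.+1 p == k) = (p == k).
Proof. by swapn_cases k.+1 p. Qed.
Lemma swapnS_ltn k p : (swapn k.+1 p < k)%N = (p < k)%N.
Proof. by swapn_cases k.+1 p. Qed.

Lemma ltnS_eq k p : (p < k.+1)%N = (p < k)%N || (p == k).
Proof. by rewrite ltnS leq_eqVlt orbC. Qed.

Definition swapnE :=
  (ltnS_eq, swapn_ltn, swapn_eq, swapn_eqS, swapn_eq2, swapnS_eq, swapnS_ltn).

(** All comparisons of a position with three consecutive ones, at once. *)
Variant pos3_spec : bool -> bool -> bool -> bool -> Type :=
| Pos3Lt : pos3_spec true false false false
| Pos3At0 : pos3_spec false true false false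
| Pos3At1 : pos3_spec false false true false
| Pos3At2 : pos3_spec false false false true
| Pos3Gt : pos3_spec false false false false.

Lemma pos3P k p :
  pos3_spec (p < k)%N (p == k) (p == k.+1) (p == k.+2).
Proof.
case: (ltnP p k) => ?; case: (eqVneq p k) => ?; case: (eqVneq p k.+1) => ?;
  case: (eqVneq p k.+2) => ?; try (exfalso; lia); constructor.
Qed.

Definition cross (k l p q : nat) : int := ((p == k) && (q == l))%:R.

Definition corr1 (k p q r : nat) : int :=
  (p < k)%N%:R * (cross k k.+1 q r - cross k.+1 k q r).

(** The degree-two value of the generator number [k]: minus the alternating
    indicator of the triples formed by the two crossing strands and a strand
    on their left. Without it the braid relation fails: for the strands 1,
    2, 3 the cocycle contributes 0 to one side and 3 to the other at
    [(1, 2, 3)]. Suppose that a crossing with one strand on its left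
    contributes [c0] times the sign of the order (left strand, crossing
    strands). Such a crossing occurs once on the first side, in odd order,
    and twice on the second, in even order; so the relation reads
    [- c0 = 3 + 2 * c0], whence the coefficient [-1]. The factor 3 in the
    cocycle makes it integral. *)
Definition corr (k p q r : nat) : int :=
  - (corr1 k p q r + corr1 k q r p + corr1 k r p q).

(** With [x, y, z] the symmetrized values on [pq, qr, rp], this is
    [3 * (x - y) * (y' - z')]. Its alternation is invariant under cyclic
    permutations and dual to the relations [[t_pq, t_qr + t_rp] = 0] of the
    Lie algebra of the pure braid group. *)
Definition tri_form (T : Type) (f g : T -> T -> int) (p q r : T) : int :=
  3 * (f p q + f q p - (f q r + f r q)) * (g q r + g r q - (g r p + g p r)).

(** Every comparison of the positions [p, q, r] with [k, k.+1, k.+2] that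
    occurs depends on which of five places each of them has: a finite check. *)
Lemma cross_near (k p q r : nat) (s := swapn k) (t := swapn k.+1)
    (a := cross k k.+1) (b := cross k k.+2) (c := cross k.+1 k.+2) :
  corr k p q r + corr k.+1 (s p) (s q) (s r)
    + corr k (t (s p)) (t (s q)) (t (s r))
    + (tri_form a b p q r + tri_form a c p q r + tri_form b c p q r) =
  corr k.+1 p q r + corr k (t p) (t q) (t r)
    + corr k.+1 (s (t p)) (s (t q)) (s (t r))
    + (tri_form c b p q r + tri_form c a p q r + tri_form b a p q r).
Proof.
rewrite /tri_form /a /b /c /s /t /corr /corr1 /cross !swapnE.
case: (pos3P k p); case: (pos3P k q); case: (pos3P k r).
all: vm_compute; reflexivity.
Qed.

(** All comparisons of a position with two distant adjacent pairs, at once. *)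
Variant pos4_spec : bool -> bool -> bool -> bool -> bool -> bool -> Type :=
| Pos4Lt : pos4_spec true false false true false false
| Pos4At0 : pos4_spec false true false true false false
| Pos4At1 : pos4_spec false false true true false false
| Pos4Mid : pos4_spec false false false true false false
| Pos4At2 : pos4_spec false false false false true false
| Pos4At3 : pos4_spec false false false false false true
| Pos4Gt : pos4_spec false false false false false false.

Lemma pos4P k l p : (k.+1 < l)%N ->
  pos4_spec (p < k)%N (p == k) (p == k.+1) (p < l)%N (p == l) (p == l.+1).
Proof.
case: (ltnP p k) => ?; case: (eqVneq p k) => ?; case: (eqVneq p k.+1) => ?;
  case: (ltnP p l) => ?; case: (eqVneq p l) => ?; case: (eqVneq p l.+1) => ? kl;
  try (exfalso; lia); constructor.
Qed.

(** Two distant crossings share no strand, so the cocycle vanishes on them;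
    the correction terms are also unaffected, as a crossing to the left
    permutes the left strands only. Again a finite check. *)
Lemma cross_far (k l p q r : nat) (s := swapn k) (t := swapn l)
    (a := cross k k.+1) (b := cross l l.+1) : (k.+1 < l)%N ->
  corr k p q r + corr l (s p) (s q) (s r) + tri_form a b p q r =
  corr l p q r + corr k (t p) (t q) (t r) + tri_form b a p q r.
Proof.
move=> kl.
have sl x : (swapn k x == l) = (x == l).
  by swapn_cases k x.
have slS x : (swapn k x == l.+1) = (x == l.+1).
  by swapn_cases k x.
have s_lt x : (swapn k x < l)%N = (x < l)%N.
  by swapn_cases k x.
have tk x : (swapn l x == k) = (x == k).
  by swapn_cases l x.
have tkS x : (swapn l x == k.+1) = (x == k.+1).
  by swapn_cases l x.
have t_lt x : (swapn l x < k)%N = (x < k)%N.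
  by swapn_cases l x.
rewrite /tri_form /a /b /s /t /corr /corr1 /cross !(sl, slS, s_lt, tk, tkS, t_lt).
case: (pos4P p kl); case: (pos4P q kl); case: (pos4P r kl);
  vm_compute; reflexivity.
Qed.

Section BraidHolonomy.
Variable n : nat.
Implicit Types (s : {perm 'I_n}) (p q r : 'I_n).

Local Notation V := {ffun 'I_n * 'I_n -> int}.
Local Notation W := {ffun 'I_n * 'I_n * 'I_n -> int}.

Definition hol_beta (u v : V) : W := [ffun t =>
  tri_form (fun p q => u (p, q)) (fun p q => v (p, q)) t.1.1 t.1.2 t.2].

Definition hol_aV s (v : V) : V := [ffun p => v (s p.1, s p.2)].
Definition hol_aW s (w : W) : W := [ffun t => w (s t.1.1, s t.1.2, s t.2)].

(** Permutations act on functions of pairs and triples of strands by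
    composition: a braid with permutation [s] takes strand [p] to position
    [s p], so [v \o s] reads data attached to positions as data attached to
    strands. *)
Definition hol_data : ext_data.
Proof.
refine (@ExtData {perm 'I_n} V W hol_aV hol_aW hol_beta _ _ _ _ _ _ _ _ _).
- by move=> v; apply/ffunP => -[p q]; rewrite ffunE !perm1.
- by move=> w; apply/ffunP => -[[p q] r]; rewrite ffunE !perm1.
- by move=> s t v; apply/ffunP => -[p q]; rewrite !ffunE !permM.
- by move=> s t w; apply/ffunP => -[[p q] r]; rewrite !ffunE !permM.
- by move=> s u v; apply/ffunP => -[p q]; rewrite !ffunE.
- by move=> s u v; apply/ffunP => -[[p q] r]; rewrite !ffunE.
- by move=> v u u'; apply/ffunP => t; rewrite !ffunE /tri_form !ffunE; ring.
- by move=> u v v'; apply/ffunP => t; rewrite !ffunE /tri_form !ffunE; ring.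
- by move=> s u v; apply/ffunP => -[[p q] r]; rewrite !ffunE /tri_form !ffunE.
Defined.

Definition hol_cross k l : V := [ffun p => cross k l (val p.1) (val p.2)].
Definition hol_corr k : W :=
  [ffun t => corr k (val t.1.1) (val t.1.2) (val t.2)].

Definition hol_gen (k : 'I_n.-1) : ext hol_data :=
  (braid_letter_perm k, hol_cross k k.+1, hol_corr k).

Lemma braid_letter_permE (k : 'I_n.-1) (p : 'I_n) :
  val (braid_letter_perm k p) = swapn k (val p).
Proof.
have kn : (k.+1 < n)%N by rewrite -ltn_predRL.
rewrite /braid_letter_perm /swapn; set k0 := widen_ord _ k.
have k0S : val (ordS k0) = k.+1 by rewrite /= modn_small.
case: tpermP => [->|->|pk pk']; rewrite ?k0S ?eqxx //=.
  by rewrite gtn_eqF.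
case: eqP => [pk0|_]; first by case: pk; exact: val_inj.
by case: eqP => [pk0|//]; case: pk'; apply: val_inj; rewrite k0S.
Qed.

Lemma tri_form_cross k l k' l' (t : 'I_n * 'I_n * 'I_n) :
  tri_form (fun p q => hol_cross k l (p, q)) (fun p q => hol_cross k' l' (p, q))
    t.1.1 t.1.2 t.2 =
  tri_form (cross k l) (cross k' l') (val t.1.1) (val t.1.2) (val t.2).
Proof. by rewrite /tri_form !ffunE. Qed.

Lemma hol_aV_cross k l k' l' (m : 'I_n.-1) : (forall p q : nat,
    cross k l (swapn m p) (swapn m q) = cross k' l' p q) ->
  hol_aV (braid_letter_perm m) (hol_cross k l) = hol_cross k' l'.
Proof.
by move=> e; apply/ffunP => t; rewrite !ffunE /= !braid_letter_permE e.
Qed.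

Lemma hol_gen_near (i j : 'I_n.-1) : j = i.+1 :> nat ->
  (hol_gen i * (hol_gen j * hol_gen i) = hol_gen j * (hol_gen i * hol_gen j))%g.
Proof.
move=> ji; rewrite !ext_mul3 /=.
have -> : (braid_letter_perm i * (braid_letter_perm j * braid_letter_perm i) =
    braid_letter_perm j * (braid_letter_perm i * braid_letter_perm j))%g.
  have := braid_perm_rel (braid_near ji).
  by rewrite /word_val !big_cons big_nil /letter_val /= !mulg1.
have e1 : hol_aV (braid_letter_perm i) (hol_cross j j.+1) = hol_cross i i.+2.
  by apply: hol_aV_cross => p q; rewrite /cross ji !swapnE.
have e2 : hol_aV (braid_letter_perm j) (hol_cross i i.+1) = hol_cross i i.+2.
  by apply: hol_aV_cross => p q; rewrite /cross ji !swapnE.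
have e3 : hol_aV (braid_letter_perm i) (hol_cross i i.+2) = hol_cross i.+1 i.+2.
  by apply: hol_aV_cross => p q; rewrite /cross !swapnE.
have e4 : hol_aV (braid_letter_perm j) (hol_cross i i.+2) = hol_cross i i.+1.
  by apply: hol_aV_cross => p q; rewrite /cross ji !swapnE.
rewrite e1 e2 e3 e4; congr (_, _, _).
  by rewrite ji addrAC [RHS]addrC addrA addrC addrA.
apply/ffunP => t; have := cross_near i (val t.1.1) (val t.1.2) (val t.2).
rewrite /= !ffunE !tri_form_cross !braid_letter_permE ji => e.
by rewrite [LHS]e.
Qed.

Lemma hol_gen_far (i j : 'I_n.-1) : (i.+1 < j)%N ->
  (hol_gen i * hol_gen j = hol_gen j * hol_gen i)%g.
Proof.
move=> ij.
rewrite [LHS]/(mul _ _) [RHS]/(mul _ _) /= /ext_mul /=.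
have e1 : hol_aV (braid_letter_perm i) (hol_cross j j.+1) = hol_cross j j.+1.
  apply: hol_aV_cross => p q; rewrite /cross /swapn; congr (_%:R); congr (_ && _).
    by case: (p =P i :> nat) => ?; [|case: (p =P i.+1) => ?]; lia.
  by case: (q =P i :> nat) => ?; [|case: (q =P i.+1) => ?]; lia.
have e2 : hol_aV (braid_letter_perm j) (hol_cross i i.+1) = hol_cross i i.+1.
  apply: hol_aV_cross => p q; rewrite /cross /swapn; congr (_%:R); congr (_ && _).
    by case: (p =P j :> nat) => ?; [|case: (p =P j.+1) => ?]; lia.
  by case: (q =P j :> nat) => ?; [|case: (q =P j.+1) => ?]; lia.
rewrite e1 e2; congr (_, _, _); last 1 first.
- apply/ffunP => t; have := cross_far (val t.1.1) (val t.1.2) (val t.2) ij.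
  by rewrite !ffunE !tri_form_cross !braid_letter_permE.
- have : (i.+1 < j)%N || (j.+1 < i)%N by rewrite ij.
  move=> /braid_far/braid_perm_rel.
  by rewrite /word_val !big_cons big_nil /letter_val /= !mulg1.
- exact: addrC.
Qed.

Lemma hol_gen_rel u v : braid_rel u v ->
  word_val hol_gen u = word_val hol_gen v.
Proof.
case=> i j ij; rewrite /word_val !big_cons big_nil /letter_val /= !mulg1.
  by case/orP: ij => ij; [|apply/esym]; exact: hol_gen_far.
exact: hol_gen_near.
Qed.

(** A degree-two truncation of the holonomy of the braid group: the
    permutation, the signed number of crossings of each ordered pair of
    strands, and one integer for each ordered triple. *)
Definition hol : braid_group n -> ext hol_data := pres_lift hol_gen.

Lemma holM : {morph hol : x y / (x * y)%g}.
Proof. exact/pres_liftM/hol_gen_rel. Qed.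

Lemma hol_pgen i : hol (pgen _ i) = hol_gen i.
Proof. exact/pres_lift_gen/hol_gen_rel. Qed.

Lemma hol_perm x : (hol x).1.1 = braid_perm x.
Proof.
apply: (@pres_ext _ _ {perm 'I_n} (fun x => (hol x).1.1)) => [y z|y z|i].
- by rewrite holM.
- exact: braid_permM.
- by rewrite hol_pgen /braid_perm pres_lift_gen //; exact: braid_perm_rel.
Qed.

End BraidHolonomy.

Section PureBraids.
Variable n : nat.
Local Notation P := (pure_braid_group n).
Implicit Types (x y : P) (p q r : 'I_n).

(** Twice the linking number of the strands [p] and [q]. *)
Definition link p q x : int :=
  (hol (val x)).1.2 (p, q) + (hol (val x)).1.2 (q, p).

Definition triple p q r x : int := (hol (val x)).2 (p, q, r).

Lemma pure_perm x : (hol (val x)).1.1 = 1%g.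
Proof. by rewrite hol_perm; apply/eqP; exact: (valP x). Qed.

Lemma linkM p q x y : link p q (x * y)%g = link p q x + link p q y.
Proof.
by rewrite /link valM holM /= pure_perm !ffunE !perm1; ring.
Qed.

(** On pure braids the action is trivial and only the cocycle remains: this
    is the defect needed for resonance. *)
Lemma tripleM p q r x y : triple p q r (x * y)%g = triple p q r x + triple p q r y
  + 3 * (link p q x - link q r x) * (link q r y - link r p y).
Proof.
by rewrite /triple /link valM holM /= pure_perm !ffunE /tri_form /= !ffunE !perm1.
Qed.

Lemma linkC p q x : link p q x = link q p x.
Proof. by rewrite /link addrC. Qed.

End PureBraids.

(** * Five resonant planes on four strands *)

Section ConjugateSquares.
Variable n : nat.
Local Notation P := (pure_braid_group n).
Implicit Types (g : braid_group n) (k : 'I_n.-1).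

Definition sigma k : braid_group n := pgen _ k.

Lemma braid_perm_sigma k : braid_perm (sigma k) = braid_letter_perm k.
Proof. by rewrite /braid_perm pres_lift_gen //; exact: braid_perm_rel. Qed.

Lemma conj_square_pure g k :
  (g * (sigma k * sigma k) * g^-1)%g \in gker (@braid_perm n).
Proof.
change (braid_perm (g * (sigma k * sigma k) * g^-1)%g == 1%g); apply/eqP.
rewrite !braid_permM (morphgV (@braid_permM n)) braid_perm_sigma.
by rewrite tperm2 mulg1 mulgV.
Qed.

Definition conj_square g k : P := Subg (conj_square_pure g k).

Definition ext_edge (x : ext (hol_data n)) p q : int :=
  (x.1.2 : {ffun 'I_n * 'I_n -> int}) (p, q).

Lemma ext_edgeM (x y : ext (hol_data n)) p q :
  ext_edge (x * y)%g p q = ext_edge x p q + ext_edge y (x.1.1 p) (x.1.1 q).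
Proof. by rewrite /ext_edge /= !ffunE. Qed.

Lemma ext_edge_sigma k p q :
  ext_edge (hol (sigma k)) p q = cross k k.+1 (val p) (val q).
Proof. by rewrite hol_pgen /ext_edge ffunE. Qed.

(** The conjugate by [g] of a full twist of two adjacent strands links
    exactly the strands that [g] brings to these positions. *)
Lemma link_conj_square g k p q : link p q (conj_square g k) =
  2 * (cross k k.+1 (val (braid_perm g p)) (val (braid_perm g q))
     + cross k k.+1 (val (braid_perm g q)) (val (braid_perm g p))).
Proof.
have e : (hol (val (conj_square g k)) * hol g =
    hol g * (hol (sigma k) * hol (sigma k)))%g.
  by rewrite -!holM /= mulgVK.
move: (conj_square g k) e => y e.
have yg p' q' : ext_edge (hol (val y) * hol g)%g p' q' =
    ext_edge (hol (val y)) p' q' + ext_edge (hol g) p' q'.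
  by rewrite ext_edgeM pure_perm !perm1.
have gs p' q' : ext_edge (hol g * (hol (sigma k) * hol (sigma k)))%g p' q' =
    ext_edge (hol g) p' q'
    + (cross k k.+1 (val (braid_perm g p')) (val (braid_perm g q'))
      + cross k k.+1 (val (braid_perm g q')) (val (braid_perm g p'))).
  rewrite ext_edgeM ext_edgeM !hol_perm braid_perm_sigma !ext_edge_sigma.
  rewrite !braid_letter_permE /cross swapn_eq swapn_eqS.
  by congr (_ + (_ + _)); rewrite andbC.
apply: (addIr (ext_edge (hol g) p q + ext_edge (hol g) q p)).
rewrite /link addrACA -[X in X + _ = _]yg -[X in _ + X = _]yg e !gs; ring.
Qed.

End ConjugateSquares.

Lemma sigma_far n (i j : 'I_n.-1) : (i.+1 < j)%N || (j.+1 < i)%N ->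
  (sigma i * sigma j = sigma j * sigma i)%g.
Proof.
move=> ij; rewrite [LHS]pres_mulE [RHS]pres_mulE.
by apply/presP; exact: (word_rel (braid_far ij)).
Qed.

Section FourStrands.
Variables (K : fieldType) (n : nat) (n4 : (4 <= n)%N).
Hypothesis charK : [pchar K] =i pred0.
Local Notation P := (pure_braid_group n).
Local Notation L := (gr P K).

Lemma intr_neq0 (m : nat) : m.+1%:R != 0 :> K.
Proof. by rewrite ((pcharf0P K).1 charK). Qed.

Definition strand i (i4 : (i < 4)%N) : 'I_n := Ordinal (leq_trans i4 n4).

Lemma three_letters : (3 <= n.-1)%N. Proof. by rewrite ltn_predRL. Qed.

Definition letter i (i3 : (i < 3)%N) : 'I_n.-1 :=
  Ordinal (leq_trans i3 three_letters).

Local Notation st i := (@strand i isT).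
Local Notation sg i := (sigma (@letter i isT)).

(** Strands are counted from 1 in these names and from 0 in [strand]. *)
Definition l12 : P -> int := link (st 0) (st 1).
Definition l13 : P -> int := link (st 0) (st 2).
Definition l14 : P -> int := link (st 0) (st 3).
Definition l23 : P -> int := link (st 1) (st 2).
Definition l24 : P -> int := link (st 1) (st 3).
Definition l34 : P -> int := link (st 2) (st 3).

Definition A12 : P := conj_square 1%g (@letter 0 isT).
Definition A23 : P := conj_square 1%g (@letter 1 isT).
Definition A34 : P := conj_square 1%g (@letter 2 isT).
Definition A13 : P := conj_square (sg 1) (@letter 0 isT).
Definition A24 : P := conj_square (sg 2) (@letter 1 isT).
Definition A14 : P := conj_square (sg 2 * sg 1)%g (@letter 0 isT).

Definition links x := [:: l12 x; l13 x; l23 x; l14 x; l24 x; l34 x].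

(** The standard generators [A_pq] for the first four strands are dual, up
    to the factor 2, to the six linking functions. *)
Lemma links_table :
  [/\ links A12 = [:: 2; 0; 0; 0; 0; 0], links A13 = [:: 0; 2; 0; 0; 0; 0],
      links A23 = [:: 0; 0; 2; 0; 0; 0]
    & [/\ links A14 = [:: 0; 0; 0; 2; 0; 0], links A24 = [:: 0; 0; 0; 0; 2; 0]
      & links A34 = [:: 0; 0; 0; 0; 0; 2]]].
Proof.
split; last split; rewrite /links /l12 /l13 /l23 /l14 /l24 /l34 !link_conj_square
  ?braid_permM ?braid_perm1 ?permM ?perm1 ?braid_perm_sigma ?braid_letter_permE;
  vm_compute; reflexivity.
Qed.

Lemma A12_A34_commute : (A12 * A34 = A34 * A12)%g.
Proof.
have ac : (sg 0 * sg 2 = sg 2 * sg 0)%g by exact: sigma_far.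
apply: val_inj; rewrite /= invg1 !mul1g !mulg1.
move: (sg 0) (sg 2) ac => a c ac; rewrite !mulgA.
rewrite -(mulgA a a c) ac mulgA ac -(mulgA (c * a)%g a c) ac mulgA.
by rewrite -(mulgA c a c) ac mulgA.
Qed.

Definition t123 : P -> int := triple (st 0) (st 1) (st 2).
Definition t124 : P -> int := triple (st 0) (st 1) (st 3).
Definition t134 : P -> int := triple (st 0) (st 2) (st 3).
Definition t234 : P -> int := triple (st 1) (st 2) (st 3).

(** The four triples of strands may be combined with integer coefficients;
    the fifth plane needs all four of them. *)
Lemma combo_resonant (e123 e124 e134 e234 : int) (a b : L 1%N -> K) :
    scalar a -> scalar b ->
    let B x y :=
      e123 * ((l12 x - l23 x) * (l23 y - l13 y)) +
      e124 * ((l12 x - l24 x) * (l24 y - l14 y)) +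
      e134 * ((l13 x - l34 x) * (l34 y - l14 y)) +
      e234 * ((l23 x - l34 x) * (l34 y - l24 y)) in
    (forall x y, (B x y - B y x)%:~R =
      a (gcls K x) * b (gcls K y) - b (gcls K x) * a (gcls K y)) ->
  resonant a b.
Proof.
move=> a_lin b_lin B BE.
pose w x := e123 * t123 x + e124 * t124 x + e134 * t134 x + e234 * t234 x.
have wM x y : w (x * y)%g = w x + w y + 3 * B x y.
  rewrite /w /t123 /t124 /t134 /t234 !tripleM !(linkC _ (st 0)).
  rewrite (linkC (st 3) (st 1)).
  by rewrite /B /l12 /l13 /l14 /l23 /l24 /l34; ring.
have BDl x y z : B (x * y)%g z = B x z + B y z.
  by rewrite /B /l12 /l13 /l14 /l23 /l24 /l34 !linkM; ring.
have BDr x y z : B x (y * z)%g = B x y + B x z.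
  by rewrite /B /l12 /l13 /l14 /l23 /l24 /l34 !linkM; ring.
apply: (@resonantI _ _ a b (fun x => (w x)%:~R / 3) (fun x y => (B x y)%:~R)) => //.
- by move=> x y z; rewrite BDr rmorphD.
- by move=> z x y; rewrite BDl rmorphD.
- by move=> x y; rewrite wM; field; exact: intr_neq0.
- by move=> x y; rewrite -BE rmorphB.
Qed.

Definition link_coord (e : 'I_5) : L 1%N -> K :=
  char_functional (fun x => ((links x)`_e - l34 x)%:~R).

Lemma link_coord_addchar (e : 'I_5) :
  addchar (fun x : P => ((links x)`_e - l34 x)%:~R : K).
Proof.
move=> x y; rewrite -rmorphD; congr (_%:~R).
by case: e => [[|[|[|[|[|//]]]]] ei];
  rewrite /= /l12 /l13 /l14 /l23 /l24 /l34 !linkM; ring.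
Qed.

Lemma link_coord_scalar e : scalar (link_coord e).
Proof. exact/char_functional_scalar/link_coord_addchar. Qed.

(** Combinations with zero coefficient sum of the six linking functions, in
    the basis [l12 - l34, l13 - l34, l23 - l34, l14 - l34, l24 - l34]. *)
Definition link_fun (y : 'rV[K]_5) : L 1%N -> K :=
  fun t => \sum_e y 0 e * link_coord e t.

Lemma link_fun_scalar y : scalar (link_fun y).
Proof.
move=> c s t; rewrite /link_fun mulr_sumr -big_split /=; apply: eq_bigr => e _.
by rewrite link_coord_scalar; ring.
Qed.

Definition row5 (c : seq int) : 'rV[K]_5 := \row_e (c`_e)%:~R.

Local Notation o5 i := (@Ordinal 5 i isT).

Lemma big_ord5 (F : 'I_5 -> K) :
  \sum_e F e = F (o5 0) + F (o5 1) + F (o5 2) + F (o5 3) + F (o5 4).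
Proof.
rewrite !big_ord_recl big_ord0 addr0 !addrA.
by congr (F _ + F _ + F _ + F _ + F _); apply: val_inj.
Qed.

Lemma link_fun_gcls y x : link_fun y (gcls K x) =
  y 0 (o5 0) * (l12 x - l34 x)%:~R + y 0 (o5 1) * (l13 x - l34 x)%:~R
  + y 0 (o5 2) * (l23 x - l34 x)%:~R + y 0 (o5 3) * (l14 x - l34 x)%:~R
  + y 0 (o5 4) * (l24 x - l34 x)%:~R.
Proof.
rewrite /link_fun big_ord5 /link_coord.
by do 5 (rewrite char_functionalE; last exact: link_coord_addchar).
Qed.

Lemma link_fun_eq0 y : (forall t, link_fun y t = 0) -> y = 0.
Proof.
move=> y0; have [t12 t13 t23 [t14 t24 _]] := links_table.
have y2 e (x : P) : link_fun y (gcls K x) = 2 * y 0 e -> y 0 e = 0.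
  rewrite y0 => /esym/eqP; rewrite mulf_eq0 (negbTE (intr_neq0 1)) /=.
  by move/eqP.
apply/rowP => -[[|[|[|[|[|//]]]]] ei]; rewrite mxE (bool_irrelevance ei isT).
- by apply: (y2 _ A12); rewrite link_fun_gcls; case: t12 => -> -> -> -> -> ->; ring.
- by apply: (y2 _ A13); rewrite link_fun_gcls; case: t13 => -> -> -> -> -> ->; ring.
- by apply: (y2 _ A23); rewrite link_fun_gcls; case: t23 => -> -> -> -> -> ->; ring.
- by apply: (y2 _ A14); rewrite link_fun_gcls; case: t14 => -> -> -> -> -> ->; ring.
- by apply: (y2 _ A24); rewrite link_fun_gcls; case: t24 => -> -> -> -> -> ->; ring.
Qed.

(** Bases of the planes of 123, 124, 134, 234 and of the matchings, in the
    coordinates of [link_fun]. For instance the last one is [X - Y] and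
    [Y - Z] for [X = l12 + l34], [Y = l13 + l24], [Z = l14 + l23]. *)
Definition plane_basis : seq (seq int * seq int) :=
  [:: ([:: 1; -1; 0; 0; 0], [:: 0; 1; -1; 0; 0]);
      ([:: 1; 0; 0; -1; 0], [:: 0; 0; 0; 1; -1]);
      ([:: 0; 1; 0; -1; 0], [:: 0; 0; 0; 1; 0]);
      ([:: 0; 0; 1; 0; -1], [:: 0; 0; 0; 0; 1]);
      ([:: 1; -1; 0; 0; -1], [:: 0; 1; -1; -1; 1])].

Definition plane1 (s : 'I_5) := row5 (nth ([::], [::]) plane_basis s).1.
Definition plane2 (s : 'I_5) := row5 (nth ([::], [::]) plane_basis s).2.

(** The form of a triple is, up to sign, the wedge of its basis; for the
    last plane [(X - Y) /\ (Y - Z)] is the alternating sum of the forms of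
    the four triples. *)
Lemma plane_resonant s :
  resonant (link_fun (plane1 s)) (link_fun (plane2 s)).
Proof.
have scal := link_fun_scalar.
case: s => [[|[|[|[|[|//]]]]] s5].
- apply: (combo_resonant (e123 := -1) (e124 := 0) (e134 := 0) (e234 := 0)) => //.
  by move=> x y; rewrite !link_fun_gcls !mxE /=; ring.
- apply: (combo_resonant (e123 := 0) (e124 := -1) (e134 := 0) (e234 := 0)) => //.
  by move=> x y; rewrite !link_fun_gcls !mxE /=; ring.
- apply: (combo_resonant (e123 := 0) (e124 := 0) (e134 := -1) (e234 := 0)) => //.
  by move=> x y; rewrite !link_fun_gcls !mxE /=; ring.
- apply: (combo_resonant (e123 := 0) (e124 := 0) (e134 := 0) (e234 := -1)) => //.
  by move=> x y; rewrite !link_fun_gcls !mxE /=; ring.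
- apply: (combo_resonant (e123 := -1) (e124 := 1) (e134 := -1) (e234 := 1)) => //.
  by move=> x y; rewrite !link_fun_gcls !mxE /=; ring.
Qed.

Definition dot5 (l c : seq int) : int :=
  l`_0 * c`_0 + l`_1 * c`_1 + l`_2 * c`_2 + l`_3 * c`_3 + l`_4 * c`_4.

(** The integer rows [l] and [m] read off the coefficients [c] and [d],
    being dual to the four given rows. *)
Lemma row5_separate (p r p' r' l m : seq int) (c d c' d' : K) :
    [/\ dot5 l p = 1, dot5 l r = 0, dot5 l p' = 0 & dot5 l r' = 0] ->
    [/\ dot5 m p = 0, dot5 m r = 1, dot5 m p' = 0 & dot5 m r' = 0] ->
    c *: row5 p + d *: row5 r = c' *: row5 p' + d' *: row5 r' ->
  c = 0 /\ d = 0.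
Proof.
move=> [lp lr lp' lr'] [mp mr mp' mr'] /rowP e.
have dotE k : c * (dot5 k p)%:~R + d * (dot5 k r)%:~R =
    c' * (dot5 k p')%:~R + d' * (dot5 k r')%:~R.
  pose f (q : 'rV[K]_5) := q 0 (o5 0) * (k`_0)%:~R + q 0 (o5 1) * (k`_1)%:~R
    + q 0 (o5 2) * (k`_2)%:~R + q 0 (o5 3) * (k`_3)%:~R + q 0 (o5 4) * (k`_4)%:~R.
  transitivity (f (c *: row5 p + d *: row5 r)).
    by rewrite /f !mxE /dot5; ring.
  by rewrite /f !e !mxE /dot5; ring.
have := dotE l; have := dotE m.
by rewrite lp lr lp' lr' mp mr mp' mr' !mulr0 !mulr1 !addr0 add0r => -> ->.
Qed.

Lemma plane_disjoint s t c d c' d' : s != t ->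
  c *: plane1 s + d *: plane2 s = c' *: plane1 t + d' *: plane2 t ->
  c *: plane1 s + d *: plane2 s = 0.
Proof.
wlog st : s t c d c' d' / (s < t)%N.
  move=> IH ne e; case: (ltngtP s t) => [st|ts|/val_inj st].
  - exact: IH e.
  - by rewrite e; apply: (IH t s c' d' c d); rewrite // eq_sym.
  - by rewrite st eqxx in ne.
move=> _ e; suff [-> ->] : c = 0 /\ d = 0 by rewrite !scale0r addr0.
move: s t e st => [[|[|[|[|[|//]]]]] s5] [[|[|[|[|[|//]]]]] t5] e // _; move: e.
- by apply: (@row5_separate _ _ _ _ [:: 0; -1; -1; 0; 0] [:: 0; 0; -1; 0; 0]).
- by apply: (@row5_separate _ _ _ _ [:: 1; 0; 0; 0; 0] [:: 0; 0; -1; 0; 0]).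
- by apply: (@row5_separate _ _ _ _ [:: 1; 0; 0; 0; 0] [:: 1; 1; 0; 0; 0]).
- by apply: (@row5_separate _ _ _ _ [:: 1; 0; 0; 1; 1] [:: 0; 0; -1; 1; 0]).
- by apply: (@row5_separate _ _ _ _ [:: 1; 0; 0; 0; 0] [:: 0; 0; 0; 0; -1]).
- by apply: (@row5_separate _ _ _ _ [:: 1; 0; 0; 0; 0] [:: 1; 0; 0; 1; 0]).
- by apply: (@row5_separate _ _ _ _ [:: 1; 1; 1; 0; 0] [:: 0; 1; 0; 0; -1]).
- by apply: (@row5_separate _ _ _ _ [:: 0; 1; 0; 0; 0] [:: 0; 1; 0; 1; 0]).
- by apply: (@row5_separate _ _ _ _ [:: 0; 1; 0; 0; -1] [:: 1; 1; 0; 1; 0]).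
- by apply: (@row5_separate _ _ _ _ [:: 0; 0; 1; -1; 0] [:: 1; 0; 1; 0; 1]).
Qed.

Lemma plane_indep s : indep (link_fun (plane1 s)) (link_fun (plane2 s)).
Proof.
move=> c d cd.
have : c *: plane1 s + d *: plane2 s = 0 *: row5 [::] + 0 *: row5 [::].
  rewrite !scale0r addr0; apply: link_fun_eq0 => t; rewrite -[RHS](cd t).
  rewrite /link_fun !mulr_sumr -big_split /=; apply: eq_bigr => e _.
  by rewrite !mxE; ring.
case: s {cd} => [[|[|[|[|[|//]]]]] s5].
- by apply: (@row5_separate _ _ _ _ [:: 1; 0; 0; 0; 0] [:: 0; 0; -1; 0; 0]).
- by apply: (@row5_separate _ _ _ _ [:: 1; 0; 0; 0; 0] [:: 0; 0; 0; 0; -1]).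
- by apply: (@row5_separate _ _ _ _ [:: 0; 1; 0; 0; 0] [:: 0; 1; 0; 1; 0]).
- by apply: (@row5_separate _ _ _ _ [:: 0; 0; 1; 0; 0] [:: 0; 0; 1; 0; 1]).
- by apply: (@row5_separate _ _ _ _ [:: 1; 0; 0; 0; 0] [:: 0; 0; -1; 0; 0]).
Qed.

End FourStrands.

(** * The three comparisons *)

Section NonIsomorphism.
Variables (K : fieldType) (n : nat) (n4 : (4 <= n)%N).
Hypothesis charK : [pchar K] =i pred0.
Local Notation LP := (gr (pure_braid_group n) K).
Local Notation LPi := (gr (Pi_group n) K).
Local Notation LW := (gr (upper_mccool_group n) K).
Local Notation o5 i := (@Ordinal 5 i isT).

Lemma indep_comp (T U : Type) (a b : U -> K) (g : T -> U) :
  (forall u, exists t, g t = u) -> indep a b -> indep (a \o g) (b \o g).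
Proof.
move=> g_surj ab c d cd; apply: ab => u.
by have [t <-] := g_surj u; exact: cd.
Qed.

Lemma scalar_comp (V W : lmodType K) (g : {linear V -> W}) (a : W -> K) :
  scalar a -> scalar (a \o g).
Proof. by move=> a_lin c x y; rewrite /= linearP a_lin. Qed.

(** Each of the five planes contains a coordinate form, and these are
    distinct since the planes meet in 0; they form a basis of the
    5-dimensional space, which therefore vanishes outside five places. The
    least [j] gives a contradiction. *)
Lemma pure_braid_not_mccool : ~ graded_lie_iso LP LW.
Proof.
move=> /graded_lie_isoP [f [g [_ g_br fK _]]].
have g_surj t : exists u, g 1%N u = t.
  by exists (f 1%N t); exact: fK.
pose lf y : LW 1%N -> K := link_fun n4 y \o g 1%N.
have lf_lin y : scalar (lf y) by exact/scalar_comp/link_fun_scalar.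
pose th y := wP_coord (lf y).
pose M e := wP_coord (link_coord (K := K) n4 e \o g 1%N).
have thE y i j : th y i j = \sum_e y 0 e * M e i j.
  rewrite /th /M /wP_coord; case: eqP => // _.
  by rewrite big1 // => e _; rewrite mulr0.
have thD c d y z i j : th (c *: y + d *: z) i j = c * th y i j + d * th z i j.
  rewrite !thE !mulr_sumr -big_split /=; apply: eq_bigr => e _.
  by rewrite !mxE; ring.
have th_eq0 y : (forall i j, th y i j = 0) -> y = 0.
  move=> y0; apply: (@link_fun_eq0 _ _ n4 charK) => u; have [t <-] := g_surj u.
  exact: (wP_coord_eq0 (lf_lin y)).
have plane s : exists t : 'I_n * 'I_n * 'I_n * K * K,
    let: (i, j, k, c, d) := t in
    [/\ (k < j)%N,
        forall p q, th (c *: plane1 K s + d *: plane2 K s) p q =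
          ((p == i) && (q == j))%:R
      & (th (plane1 K s) i k != 0) || (th (plane2 K s) i k != 0)].
  have [i [j [k [kj ji [c [d cd]] ik _]]]] :=
    wP_resonant_plane (lf_lin _) (lf_lin _)
      (resonant_pull g_br (plane_resonant n4 charK s))
      (indep_comp g_surj (@plane_indep _ _ n4 charK s)).
  by exists (i, j, k, c, d); split=> // p q; rewrite thD cd.
have {plane} [D DP] := choice plane.
pose i s := (D s).1.1.1.1; pose j s := (D s).1.1.1.2; pose k s := (D s).1.1.2.
pose u s := (D s).1.2 *: plane1 K s + (D s).2 *: plane2 K s.
have kj s : (k s < j s)%N.
  by move: (DP s); rewrite /k /j; case: (D s) => [[[[]]]] ? ? ? ? ? [].
have uE s p q : th (u s) p q = ((p == i s) && (q == j s))%:R.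
  by move: (DP s); rewrite /u /i /j; case: (D s) => [[[[]]]] ? ? ? ? ? [].
have ik s : (th (plane1 K s) (i s) (k s) != 0) ||
    (th (plane2 K s) (i s) (k s) != 0).
  by move: (DP s); rewrite /i /k; case: (D s) => [[[[]]]] ? ? ? ? ? [].
have ij_inj s t : (i s == i t) && (j s == j t) -> s = t.
  move=> /andP[/eqP ist /eqP jst]; apply/eqP/negPn/negP => st.
  have ust : u s = u t.
    apply/eqP; rewrite -subr_eq0; apply/eqP/th_eq0 => p q.
    by rewrite -[u s]scale1r -scaleN1r thD !uE ist jst; ring.
  have us0 : u s = 0 by exact: (plane_disjoint st ust).
  have := uE s (i s) (j s).
  rewrite us0 thE big1 => [/esym/eqP|e _]; last by rewrite mxE mul0r.
  by rewrite !eqxx oner_eq0.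
pose U := \matrix_(s, e) u s 0 e : 'M[K]_5.
pose N := \matrix_(e, s) M e (i s) (j s) : 'M[K]_5.
have UN : U *m N = 1%:M.
  apply/matrixP => s t; rewrite !mxE.
  transitivity (th (u s) (i t) (j t)).
    by rewrite thE; apply: eq_bigr => e _; rewrite !mxE.
  rewrite uE; congr (_%:R); congr nat_of_bool.
  by apply/idP/eqP => [/ij_inj -> //|->]; rewrite !eqxx.
(* the coordinate forms are dual to evaluation at their places, and square
   matrices that are inverse on one side are inverse on both *)
have NU := mulmx1C UN.
have outside p q y : (forall s, ~~ ((p == i s) && (q == j s))) -> th y p q = 0.
  move=> out; pose col := \col_e M e p q.
  have Ucol : U *m col = 0.
    apply/colP => s; rewrite !mxE; transitivity (th (u s) p q).
      by rewrite thE; apply: eq_bigr => e _; rewrite !mxE.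
    by rewrite uE (negbTE (out s)).
  transitivity ((y *m col) 0 0).
    by rewrite thE mxE; apply: eq_bigr => e _; rewrite !mxE.
  by rewrite -[y]mulmx1 -NU -!mulmxA Ucol !mulmx0 mxE.
have [s0 _ s0_min] := arg_minnP (fun s : 'I_5 => j s : nat) (erefl (xpredT (o5 0))).
have out s : ~~ ((i s0 == i s) && (k s0 == j s)).
  apply/negP => /andP[_ /eqP kjs]; have := s0_min s isT.
  by rewrite -kjs leqNgt kj.
by have := ik s0; rewrite !outside // eqxx.
Qed.

Lemma Pi_supp_eq0 (a : LPi 1%N -> K) (i : 'I_n.-1) : scalar a -> Pi_supp i a ->
  (forall k, a (gcls K (Pi_inj (pgen _ k : free_group i.+1))) = 0) ->
  forall t, a t = 0.
Proof.
move=> a_lin ai a0; apply: gcls_eq0 => // x.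
rewrite -[RHS]/((fun=> 0 : K) (gcls K x)); move: x.
apply: (Pi_functional_eq (b := fun=> 0)) => // [c x y|j k].
  by rewrite mulr0 addr0.
by case: (eqVneq j i) k => [->|ji] k; [exact: a0 | exact: ai].
Qed.

(** The three forms [u], [v] and [u - v] below, taken in three different
    planes, each live on one factor; so all live on the same one, and [u],
    [v] are resonant although the commuting elements [A12] and [A34] show
    that they are not. *)
Lemma pure_braid_not_Pi : ~ graded_lie_iso LP LPi.
Proof.
move=> /graded_lie_isoP [f [g [f_br g_br fK _]]].
have g_surj t : exists u, g 1%N u = t.
  by exists (f 1%N t); exact: fK.
pose lf y : LPi 1%N -> K := link_fun n4 y \o g 1%N.
have lf_lin y : scalar (lf y) by exact/scalar_comp/link_fun_scalar.
have supp s : exists i, Pi_supp i (lf (plane1 K s)) /\ Pi_supp i (lf (plane2 K s)).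
  apply: resonant_Pi_supp => //.
    exact: (resonant_pull g_br (plane_resonant n4 charK s)).
  exact: (indep_comp g_surj (@plane_indep _ _ n4 charK s)).
have [i [ui _]] := supp (o5 0).
have [i' [_ vi']] := supp (o5 3).
have [i'' [wi'' _]] := supp (o5 4).
set u := plane1 K (o5 0) in ui; set v := plane2 K (o5 3) in vi'.
set w := plane1 K (o5 4) in wi''.
have uvw t : lf u t = lf v t + lf w t.
  rewrite /lf /= /link_fun -big_split /=; apply: eq_bigr => e _.
  rewrite -mulrDl; congr (_ * _).
  by rewrite !mxE; case: e => [[|[|[|[|[|//]]]]] e5] /=; ring.
have [T12 _ _ [_ _ T34]] := links_table n4.
have lfE y x : lf y (f 1%N (gcls K x)) = link_fun n4 y (gcls K x).
  rewrite -[LHS]/(link_fun n4 y (g 1%N (f 1%N (gcls K x)))).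
  by congr (link_fun n4 y _); exact: (fK 1%N).
have u12 : link_fun n4 u (gcls K (A12 n4)) = 2.
  by rewrite link_fun_gcls !mxE /=; case: T12 => -> -> -> -> -> ->; ring.
have u34 : link_fun n4 u (gcls K (A34 n4)) = 0.
  by rewrite link_fun_gcls !mxE /=; case: T34 => -> -> -> -> -> ->; ring.
have v34 : link_fun n4 v (gcls K (A34 n4)) = - 2.
  by rewrite link_fun_gcls !mxE /=; case: T34 => -> -> -> -> -> ->; ring.
have two0 : 2 != 0 :> K by exact: (intr_neq0 charK 1).
have [ii'|ii'] := eqVneq i' i.
  subst i'.
  have uv_res := Pi_supp_resonant (lf_lin u) (lf_lin v) ui vi'.
  move: (resonant_pull f_br uv_res) => /(resonant_commute (A12_A34_commute n4)).
  rewrite /= !lfE u12 u34 v34 mulr0 mulrN => /eqP.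
  by rewrite oppr_eq0 mulf_eq0 !(negbTE two0).
have [ii''|ii''] := eqVneq i'' i.
  subst i''; have v0 : forall t, lf v t = 0.
    apply: (Pi_supp_eq0 (lf_lin v) vi') => k.
    by have := uvw (gcls K (Pi_inj (pgen _ k : free_group i'.+1)));
       rewrite ui // wi'' // addr0.
  have /eqP := v0 (f 1%N (gcls K (A34 n4))).
  by rewrite lfE v34 oppr_eq0 (negbTE two0).
have u0 : forall t, lf u t = 0.
  apply: (Pi_supp_eq0 (lf_lin u) ui) => k.
  by rewrite uvw vi' ?wi'' ?addr0 // eq_sym.
by have /eqP := u0 (f 1%N (gcls K (A12 n4))); rewrite lfE u12 (negbTE two0).
Qed.

(** In the span of three forms living on the last factor all pairs are
    resonant. It contains two distinct coordinate forms, and these cannot be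
    resonant. *)
Lemma Pi_not_mccool : ~ graded_lie_iso LPi LW.
Proof.
move=> /graded_lie_isoP [f [g [_ g_br fK _]]].
have g_surj t : exists u, g 1%N u = t.
  by exists (f 1%N t); exact: fK.
have n2 : (n.-2 < n.-1)%N by rewrite ltn_predL; lia.
pose i : 'I_n.-1 := Ordinal n2.
have i3 : (2 < i.+1)%N by rewrite /=; lia.
pose o (k : 'I_3) : 'I_i.+1 := widen_ord i3 k.
have [X XP] := choice (fun k => Pi_coordinate (i := i) (fun l => (l == o k)%:R : K)).
have X_lin k : scalar (X k) by case: (XP k).
have X_supp k : Pi_supp i (X k) by case: (XP k).
have XE k l : X k (gcls K (Pi_inj (pgen _ (o l) : free_group i.+1))) = (k == l)%:R.
  case: (XP k) => _ _ ->; congr (nat_of_bool _)%:R.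
  by rewrite -!(inj_eq val_inj) /= eq_sym.
pose lin2 c k d l t := c * X k t + d * X l t.
have lin2_lin c k d l : scalar (lin2 c k d l).
  by move=> e x y; rewrite /lin2 !X_lin; ring.
have lin2_supp c k d l : Pi_supp i (lin2 c k d l).
  by move=> j m ji; rewrite /lin2 !X_supp // !mulr0 addr0.
pose th (a : LPi 1%N -> K) := wP_coord (a \o g 1%N).
have th2 c k d l p q : th (lin2 c k d l) p q = c * th (X k) p q + d * th (X l) p q.
  by rewrite /th /wP_coord; case: eqP => // _; rewrite !mulr0 addr0.
have X_ind k l : k != l -> indep (X k) (X l).
  move=> kl c d cd; split.
    have := cd (gcls K (Pi_inj (pgen _ (o k) : free_group i.+1))).
    by rewrite !XE eqxx eq_sym (negbTE kl) mulr1 mulr0 addr0.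
  have := cd (gcls K (Pi_inj (pgen _ (o l) : free_group i.+1))).
  by rewrite !XE eqxx (negbTE kl) mulr1 mulr0 add0r.
have delta k l : k != l -> exists c d p q, forall p' q',
    th (lin2 c k d l) p' q' = ((p' == p) && (q' == q))%:R.
  move=> kl.
  have [p [q [_ [_ _ [c [d cd]] _ _]]]] := wP_resonant_plane
    (scalar_comp (g 1%N) (X_lin k)) (scalar_comp (g 1%N) (X_lin l))
    (resonant_pull g_br (Pi_supp_resonant (X_lin k) (X_lin l) (X_supp k) (X_supp l)))
    (indep_comp g_surj (X_ind k l kl)).
  by exists c, d, p, q => p' q'; rewrite th2 cd.
have two_delta c k d l c' k' d' l' p q p' q' :
    (forall r s, th (lin2 c k d l) r s = ((r == p) && (s == q))%:R) ->
    (forall r s, th (lin2 c' k' d' l') r s = ((r == p') && (s == q'))%:R) ->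
    (p, q) = (p', q').
  set a := lin2 c k d l; set b := lin2 c' k' d' l' => aE bE.
  apply: contrapT => pq.
  have ab_ind : indep a b.
    move=> e h eh.
    have ehE r s : e * th a r s + h * th b r s = 0.
      by rewrite /th /wP_coord; case: eqP => [rs|_]; [exact: eh | ring].
    have qp : (p == p') && (q == q') = false.
      by apply/negP => /andP[/eqP pp /eqP qq]; apply: pq; rewrite pp qq.
    split; [have := ehE p q | have := ehE p' q']; rewrite aE bE !eqxx.
      by rewrite qp mulr0 addr0 mulr1.
    by rewrite ![p' == _]eq_sym ![q' == _]eq_sym qp mulr0 add0r mulr1.
  have [r [s [t [ts sr [e [h eh]] rt st]]]] := wP_resonant_plane
    (scalar_comp (g 1%N) (lin2_lin _ _ _ _)) (scalar_comp (g 1%N) (lin2_lin _ _ _ _))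
    (resonant_pull g_br (Pi_supp_resonant (lin2_lin _ _ _ _) (lin2_lin _ _ _ _)
       (lin2_supp c k d l) (lin2_supp c' k' d' l')))
    (indep_comp g_surj ab_ind).
  have in2 x y : (th a x y != 0) || (th b x y != 0) ->
      (x, y) = (p, q) \/ (x, y) = (p', q').
    rewrite aE bE; case: (boolP (_ && _)) => [/andP[/eqP-> /eqP->] _|_].
      by left.
    case: (boolP (_ && _)) => [/andP[/eqP-> /eqP->] _|_]; first by right.
    by rewrite eqxx.
  have rs : (th a r s != 0) || (th b r s != 0).
    apply/negPn/negP; rewrite negb_or !negbK => /andP[/eqP a0 /eqP b0].
    have := eh r s; rewrite -/(th a) -/(th b) a0 b0 !mulr0 addr0 !eqxx.
    by move/esym/eqP; rewrite oner_eq0.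
  have [nst nsr] : t <> s /\ s <> r.
    by split=> e0; [move: ts | move: sr]; rewrite e0 ltnn.
  case: (in2 _ _ rt) (in2 _ _ st) (in2 _ _ rs) => -[r0 t0] [] [s0 t1] [] [r1 s1];
    by move: nst nsr; congruence.
have key k l m c d p q : k != l -> k != m -> l != m -> c != 0 ->
    ~ (forall r s, th (lin2 c k d l) r s = ((r == p) && (s == q))%:R).
  move=> kl km lm c0 cE.
  have [c' [d' [p' [q' cE']]]] := delta l m lm.
  have [pp' qq'] := two_delta _ _ _ _ _ _ _ _ _ _ _ _ cE cE'.
  case/eqP: c0.
  pose D t := lin2 c k d l t - lin2 c' l d' m t.
  have D0 t : D t = 0.
    have [t' <-] := g_surj t; move: t'; apply: (@wP_coord_eq0 _ _ (D \o g 1%N)).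
      by apply: scalar_comp => e x y; rewrite /D !lin2_lin; ring.
    move=> r s; transitivity (th (lin2 c k d l) r s - th (lin2 c' l d' m) r s).
      by rewrite /th /wP_coord /D; case: eqP; rewrite // subrr.
    by rewrite cE cE' pp' qq' subrr.
  have := D0 (gcls K (Pi_inj (pgen _ (o k) : free_group i.+1))).
  rewrite /D /lin2 !XE eqxx ![_ == k]eq_sym (negbTE kl) (negbTE km).
  by rewrite !mulr0 !addr0 mulr1 subr0.
have [c [d [p [q cd]]]] := delta (@Ordinal 3 0 isT) (@Ordinal 3 1 isT) isT.
have [c0|c0] := eqVneq c 0; last first.
  exact: (key _ _ (@Ordinal 3 2 isT) _ _ _ _ _ _ _ c0 cd).
apply: (key _ _ (@Ordinal 3 2 isT) d c p q) => [||||r s].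
- exact: (erefl : @Ordinal 3 1 isT != @Ordinal 3 0 isT).
- by [].
- by [].
- apply/eqP => d0; have := cd p q; rewrite th2 c0 d0 !mul0r addr0 !eqxx.
  by move/esym/eqP; rewrite oner_eq0.
- by rewrite th2 addrC -th2 cd.
Qed.

End NonIsomorphism.

Local Close Scope ring_scope.

Theorem proposition1p4 (K : fieldType) (charK : ([pchar K] =i pred0)%R)
    (n : nat) (n_ge4 : 4 <= n) :
  [/\ ~ graded_lie_iso (gr (pure_braid_group n) K) (gr (Pi_group n) K),
      ~ graded_lie_iso (gr (pure_braid_group n) K)
                       (gr (upper_mccool_group n) K)
    & ~ graded_lie_iso (gr (Pi_group n) K) (gr (upper_mccool_group n) K)].
Proof.
split; first exact: pure_braid_not_Pi.
  exact: pure_braid_not_mccool.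
exact: Pi_not_mccool.
Qed.
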